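(* For every representation $M$ of $A$, the Newton polytope satisfies $$\mathsf{N}(M)=\{\gamma\in\mathbb{R}^{Q_0}\mid \delta(\gamma)\le\hom(\delta,M)\ \ \forall\delta\in\mathbb{Z}^{Q_0}\},$$ and the dual Newton polytope satisfies $$\check{\mathsf{N}}(M)=\{\gamma\in\mathbb{R}^{Q_0}\mid \check\delta(\gamma)\le\hom(M,\check\delta)\ \ \forall\check\delta\in\mathbb{Z}^{Q_0}\}.$$
   Context: $A=kQ/I$ is a finite-dimensional basic algebra over an algebraically closed field $k$ of characteristic $0$; representations are finite-dimensional right $A$-modules. $\mathsf{N}(M)$ is the convex hull in $\mathbb{R}^{Q_0}$ of the dimension vectors of all subrepresentations of $M$; $\check{\mathsf{N}}(M)$ is the convex hull of dimension vectors of all quotient representations of $M$. $\delta(\gamma)=\sum_v\delta(v)\gamma(v)$. $\hom(\delta,M)$ is $\dim\ker(\Hom_A(P_+,M)\to\Hom_A(P_-,M))$ for a general $d:P_-\to P_+$ in $\mathrm{PHom}(\delta)=\Hom_A(P([-\delta]_+),P([\delta]_+))$; $\hom(M,\check\delta)$ is $\dim\ker(\Hom_A(M,I_+)\to\Hom_A(M,I_-))$ for a general $I_+\to I_-$ in $\mathrm{IHom}(\check\delta)=\Hom_A(I([\check\delta]_+),I([-\check\delta]_+))$; here $P(\beta)=\bigoplus P_v^{\oplus\beta(v)}$, $I(\beta)=\bigoplus I_v^{\oplus\beta(v)}$, $[\delta]_+=\max(\delta,0)$. *)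

(* Defs.v *)
From HB Require Import structures.
From mathcomp Require Import all_boot all_order all_algebra.
From Stdlib Require Import ClassicalEpsilon.
Set Implicit Arguments. Unset Strict Implicit. Unset Printing Implicit Defensive.
Import Order.TTheory GRing.Theory Num.Theory.
Local Open Scope ring_scope.

(* An element of kQ is a finite formal linear combination of paths,    *)
(* encoded as  seq (k * seq Ar).                                       *)

Section Quiver.
Variables (n : nat) (Ar : finType) (src tgt : Ar -> 'I_n).

Fixpoint composable (s : seq Ar) : bool :=
  match s with
  | a :: ((b :: _) as s') => (tgt a == src b) && composable s'
  | _ => true
  end.

Definition path_from_to (v u : 'I_n) (s : seq Ar) : bool :=
  [&& composable s, head None (map (fun a => Some (src a)) s) == Some v
    & last None (map (fun a => Some (tgt a)) s) == Some u].

Definition path_len_ge (m : nat) (s : seq Ar) := (m <= size s)%N.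

Variable k : fieldType.

Definition coef (f : seq (k * seq Ar)) (w : seq Ar) : k :=
  \sum_(x <- f | x.2 == w) x.1.

(* formal product  u * f * w  in kQ for paths u, w (u, w = [::] means no
   factor on that side); non-composable products are zero in kQ. *)
Definition fmul (u : seq Ar) (f : seq (k * seq Ar)) (w : seq Ar) :
  seq (k * seq Ar) :=
  [seq (x.1, u ++ x.2 ++ w) | x <- f & composable (u ++ x.2 ++ w)].

Definition fscale (c : k) (f : seq (k * seq Ar)) : seq (k * seq Ar) :=
  [seq (c * x.1, x.2) | x <- f].

Definition in_ideal (r : nat) (Rel : 'I_r -> seq (k * seq Ar))
    (f : seq (k * seq Ar)) : Prop :=
  exists ts : seq (k * seq Ar * 'I_r * seq Ar),
    forall w, coef f w =
      coef (flatten [seq fscale t.1.1.1 (fmul t.1.1.2 (Rel t.1.2) t.2) | t <- ts]) w.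

(* The ideal I = (Rel) is admissible, Rel being uniform relations:
   each relation is a combination of paths of length >= 2 with common
   source and target (so I <= R_Q^2), and R_Q^m <= I for some m, i.e.
   every path of length m lies in I (so A = kQ/I is finite-dimensional). *)
Definition admissible (r : nat) (Rel : 'I_r -> seq (k * seq Ar)) : Prop :=
  (forall i, exists v u, all (fun x => path_from_to v u x.2 && path_len_ge 2 x.2)
                            (Rel i)) /\
  (exists m : nat, forall s : seq Ar, composable s -> size s = m ->
      in_ideal Rel [:: (1, s)]).

(* A representation of A = kQ/I, i.e. a finite-dimensional right       *)
(* A-module, is k^D (row vectors) with the action of e_v and of the    *)
(* arrows given by right multiplication by matrices E v, X a.          *)
Variable D : nat.
Implicit Types (E : 'I_n -> 'M[k]_D) (X : Ar -> 'M[k]_D).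

(* action of a path (product in path order: right module) *)
Definition evw X (s : seq Ar) : 'M[k]_D := foldr (fun a m => X a *m m) 1%:M s.

Definition evf X (f : seq (k * seq Ar)) : 'M[k]_D := \sum_(x <- f) x.1 *: evw X x.2.

Definition is_rep (r : nat) (Rel : 'I_r -> seq (k * seq Ar)) E X : Prop :=
  [/\ forall v, E v *m E v = E v,
      forall v w, v != w -> E v *m E w = 0,
      \sum_v E v = 1%:M,
      forall a, X a = E (src a) *m X a *m E (tgt a)
    & forall i, evf X (Rel i) = 0].

Definition is_subrep E X (U : 'M[k]_D) : bool :=
  [forall v, (U *m E v <= U)%MS] && [forall a, (U *m X a <= U)%MS].

Definition subdim E (U : 'M[k]_D) (v : 'I_n) : nat := \rank (U *m E v).
Definition quotdim E (U : 'M[k]_D) (v : 'I_n) : nat :=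
  (\rank (E v) - \rank (U *m E v))%N.

Definition ev E X (v u : 'I_n) (f : seq (k * seq Ar)) : 'M[k]_D :=
  E v *m evf X f *m E u.

Definition posp (z : int) : nat := match z with Posz m => m | Negz _ => 0%N end.

(* the vertices of the indecomposable summands of P([d]_+) (with
   multiplicity), in some fixed order *)
Definition vlist (d : 'I_n -> int) : seq 'I_n :=
  flatten [seq nseq (posp (d v)) v | v <- enum 'I_n].

Definition vof (d : 'I_n -> int) : 'I_(size (vlist d)) -> 'I_n :=
  tnth (in_tuple (vlist d)).

(* hom(delta, M): for d : P([-delta]_+) -> P([delta]_+) whose component
   P_u -> P_v is left multiplication by an element a of e_v A e_u,
   Hom(P([delta]_+), M) = (+)_j M e_(v_j) (row vectors) and the induced
   map is (m_j)_j |-> (sum_j m_j a_(j,i))_i.  dimkerP = dim of its kernel. *)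
Definition dimkerP E X (delta : 'I_n -> int)
    (a : 'I_(size (vlist delta)) -> 'I_(size (vlist (fun v => - delta v))) ->
         seq (k * seq Ar)) : nat :=
  let vp := @vof delta in let vm := @vof (fun v => - delta v) in
  let W := \mxdiag_(j < size (vlist delta)) E (vp j) in
  let Phi := \mxblock_(j < size (vlist delta), i < size (vlist (fun v => - delta v)))
               ev E X (vp j) (vm i) (a j i) in
  (\rank W - \rank (W *m Phi))%N.

(* hom(M, delta'): for a map I([delta']_+) -> I([-delta']_+) whose component
   I_u -> I_v is D(right multiplication by a in e_v A e_u),
   Hom(M, I([delta']_+)) = (+)_j D(M e_(u_j)) (column vectors phi_j with
   phi_j = E u_j phi_j) and the induced map is
   (phi_j)_j |-> (sum_j a_(j,i) phi_j)_i.  dimkerI = dim of its kernel. *)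
Definition dimkerI E X (delta : 'I_n -> int)
    (a : 'I_(size (vlist delta)) -> 'I_(size (vlist (fun v => - delta v))) ->
         seq (k * seq Ar)) : nat :=
  let vp := @vof delta in let vm := @vof (fun v => - delta v) in
  let W := \mxdiag_(j < size (vlist delta)) E (vp j) in
  let Psi := \mxblock_(i < size (vlist (fun v => - delta v)), j < size (vlist delta))
               ev E X (vm i) (vp j) (a j i) in
  (\rank W - \rank (Psi *m W))%N.

End Quiver.

(* minimum value of a nat-valued function on a nonempty type; for the
   dimension of a kernel of a linear family this is its value at a
   general point (rank is lower semicontinuous). *)
Lemma gen_min_ex (T : Type) (f : T -> nat) (t0 : T) :
  exists h, (fun h => if excluded_middle_informative (exists t, f t = h)
                      then true else false) h.
Proof.
exists (f t0); case: excluded_middle_informative => // [[]]; by exists t0.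
Qed.

Definition gen_min (T : Type) (f : T -> nat) (t0 : T) : nat :=
  ex_minn (gen_min_ex f t0).

Definition homP (n : nat) (Ar : finType) (k : fieldType) (D : nat)
    (E : 'I_n -> 'M[k]_D) (X : Ar -> 'M[k]_D) (delta : 'I_n -> int) : nat :=
  gen_min (dimkerP E X (delta := delta)) (fun _ _ => [::]).

Definition homI (n : nat) (Ar : finType) (k : fieldType) (D : nat)
    (E : 'I_n -> 'M[k]_D) (X : Ar -> 'M[k]_D) (delta : 'I_n -> int) : nat :=
  gen_min (dimkerI E X (delta := delta)) (fun _ _ => [::]).

Definition pairing (R : numDomainType) (n : nat) (delta : 'I_n -> int)
    (gamma : 'I_n -> R) : R := \sum_v (delta v)%:~R * gamma v.

Definition in_conv_hull (R : numDomainType) (n : nat) (T : Type) (P : T -> Prop)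
    (dv : T -> 'I_n -> nat) (gamma : 'I_n -> R) : Prop :=
  exists (m : nat) (lam : 'I_m -> R) (U : 'I_m -> T),
    [/\ forall i, 0 <= lam i, forall i, P (U i), \sum_i lam i = 1
      & forall v, gamma v = \sum_i lam i * ((dv (U i) v)%:R)].

(* Main.v *)
(* For d : P_- -> P_+ and a subrepresentation L of M, delta(dim L) <=
   hom(d, L) <= hom(d, M) gives the easy inclusion.  For the other one, Farkas'
   lemma with integer certificates shows that it is enough to find, for each
   delta, some m > 0 with hom(m delta, M) = m max_L delta(dim L).
   The pairs (d, phi) with phi : P_+ -> M and phi d = 0 form a family of
   dimension at least dim PHom(m delta) + hom(m delta, M).  Those where phi has
   image L are parametrised by the position of L in M (C parameters, C not
   depending on m), by phi in Hom(P_+, L), and by d with values in the kernel of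
   P_+ -> L: in total C + dim PHom(m delta) + m delta(dim L) parameters.  One can
   take C = 0 when L is 0 or M, so the equality holds for large m if no proper
   nonzero L maximises delta.  If some L does, a general presentation is treated
   on L and on M/L, by induction on the dimension.
   The statement on quotients is the first one for the dual representation. *)
Require Import Defs.
From HB Require Import structures.
From mathcomp Require Import all_boot all_order all_algebra.
From mathcomp Require Import zify lra.
From Stdlib Require Import ClassicalEpsilon.
Set Implicit Arguments. Unset Strict Implicit. Unset Printing Implicit Defensive.
Import Order.TTheory GRing.Theory Num.Theory.
Local Open Scope ring_scope.

(** * Polynomial functions *)

Section PolynomialFunctions.
Variable k : fieldType.
Implicit Types I : finType.

(** Dimensions are counted without varieties. [generic] means: off the zero set of one nonzero
    polynomial function. The only geometric fact is that polynomial maps from finitely many affine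
    spaces of dimension below N land in one hypersurface of N-space. To apply it, h entries of phi
    are adjoined to d. If hom(d, M) >= h, some h entries of phi can be prescribed at will, so d
    completed by any h values lies in the image of some stratum; freezing these values leaves a
    nonzero polynomial in d that vanishes wherever hom(d, M) >= h. The strata are finite in number:
    all matrices keep size D, and L enters through discrete choices (is it 0, M or neither, which
    rows are independent, which entries are prescribed). The constant C is harmless because delta is
    integral on dimension vectors: an L that is not maximal loses at least 1 against delta, hence m
    against m delta. The algebra acts through its image in End(M), spanned by finitely many paths;
    with fixed structure constants, one list t of coefficients defines the presentation on L, M and
    M/L at once. *)

Definition line I (x y : {ffun I -> k}) (z : k) : {ffun I -> k} :=
  [ffun i => x i + z * y i].

(** Polynomiality is tested on lines, with one degree bound for all of them; this is all that the
    grid arguments use. *)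
Definition polydeg I (e : nat) (f : {ffun I -> k} -> k) : Prop :=
  forall x y, exists2 p : {poly k}, (size p <= e.+1)%N &
    forall z, f (line x y z) = p.[z].

Definition polyfun I (f : {ffun I -> k} -> k) : Prop := exists e, polydeg e f.

Lemma eq_polydeg I e (f g : {ffun I -> k} -> k) :
  f =1 g -> polydeg e f -> polydeg e g.
Proof.
move=> fg hf x y; case: (hf x y) => p sp hp.
by exists p => // z; rewrite -fg.
Qed.

Lemma eq_polyfun I (f g : {ffun I -> k} -> k) : f =1 g -> polyfun f -> polyfun g.
Proof. by move=> fg [e hf]; exists e; apply: eq_polydeg hf. Qed.

Lemma polydegW I e e' (f : {ffun I -> k} -> k) :
  (e <= e')%N -> polydeg e f -> polydeg e' f.
Proof.
move=> le hf x y; case: (hf x y) => p sp hp; exists p => //.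
exact: leq_trans sp _.
Qed.

Lemma polydeg_cst I (c : k) : polydeg 0 (fun _ : {ffun I -> k} => c).
Proof. by move=> x y; exists c%:P => [|z]; rewrite ?size_polyC_leq1 ?hornerC. Qed.

Lemma polydeg_coord I (i : I) : polydeg 1 (fun u : {ffun I -> k} => u i).
Proof.
move=> x y; exists ((y i) *: 'X + (x i)%:P) => [|z].
  apply: leq_trans (size_polyD _ _) _; rewrite geq_max.
  rewrite (leq_trans (size_scale_leq _ _)) ?size_polyX //.
  by rewrite (leq_trans (size_polyC_leq1 _)).
by rewrite !hornerE ffunE addrC mulrC.
Qed.

Lemma polydegM I e1 e2 (f g : {ffun I -> k} -> k) :
  polydeg e1 f -> polydeg e2 g -> polydeg (e1 + e2) (fun u => f u * g u).
Proof.
move=> hf hg x y; case: (hf x y) => p sp hp; case: (hg x y) => q sq hq.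
exists (p * q) => [|z]; last by rewrite hornerM hp hq.
by apply: leq_trans (size_polyMleq _ _) _; lia.
Qed.

Lemma polydegD I e (f g : {ffun I -> k} -> k) :
  polydeg e f -> polydeg e g -> polydeg e (fun u => f u + g u).
Proof.
move=> hf hg x y; case: (hf x y) => p sp hp; case: (hg x y) => q sq hq.
exists (p + q) => [|z]; last by rewrite hornerD hp hq.
by apply: leq_trans (size_polyD _ _) _; rewrite geq_max sp.
Qed.

Lemma polydeg_horner I e (q : {poly k}) m (f : {ffun I -> k} -> k) :
  (size q <= m.+1)%N -> polydeg e f -> polydeg (m * e) (fun u => q.[f u]).
Proof.
move=> sq hf x y; case: (hf x y) => p sp hp.
exists (q \Po p) => [|z]; last by rewrite horner_comp hp.
apply: leq_trans (size_comp_poly_leq _ _) _; rewrite ltnS leq_mul //; lia.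
Qed.

Lemma polydeg_sum I (J : Type) (r : seq J) (P : pred J) e
    (f : J -> {ffun I -> k} -> k) :
  (forall j, polydeg e (f j)) -> polydeg e (fun u => \sum_(j <- r | P j) f j u).
Proof.
move=> hf; elim: r => [|j r IH].
  apply: (eq_polydeg _ (polydegW (leq0n e) (@polydeg_cst I 0))) => u.
  by rewrite big_nil.
case: (boolP (P j)) => Pj.
  by apply: (eq_polydeg _ (polydegD (hf j) IH)) => u; rewrite big_cons Pj.
by apply: (eq_polydeg _ IH) => u; rewrite big_cons (negbTE Pj).
Qed.

Lemma polydeg_prod I (J : finType) e (f : J -> {ffun I -> k} -> k) :
  (forall j, polydeg e (f j)) -> polydeg (#|J| * e) (fun u => \prod_j f j u).
Proof.
move=> hf; have H r : polydeg (size r * e) (fun u => \prod_(j <- r) f j u).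
  elim: r => [|j r IH].
    by apply: (eq_polydeg _ (@polydeg_cst I 1)) => u; rewrite big_nil.
  by rewrite mulSn; apply: (eq_polydeg _ (polydegM (hf j) IH)) => u; rewrite big_cons.
by have := H (index_enum J); rewrite -sum1_size sum1_card.
Qed.

Lemma polyfun_cst I (c : k) : polyfun (fun _ : {ffun I -> k} => c).
Proof. by exists 0%N; apply: polydeg_cst. Qed.

Lemma polyfun_coord I (i : I) : polyfun (fun u : {ffun I -> k} => u i).
Proof. by exists 1%N; apply: polydeg_coord. Qed.

Lemma polyfunM I (f g : {ffun I -> k} -> k) :
  polyfun f -> polyfun g -> polyfun (fun u => f u * g u).
Proof. by move=> [e hf] [e' hg]; exists (e + e')%N; apply: polydegM. Qed.

Lemma polyfunD I (f g : {ffun I -> k} -> k) :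
  polyfun f -> polyfun g -> polyfun (fun u => f u + g u).
Proof.
move=> [e hf] [e' hg]; exists (maxn e e').
by apply: polydegD; [apply: polydegW hf | apply: polydegW hg]; rewrite ?leq_maxl ?leq_maxr.
Qed.

Lemma polyfunN I (f : {ffun I -> k} -> k) : polyfun f -> polyfun (fun u => - f u).
Proof.
move=> hf; apply: (eq_polyfun _ (polyfunM (@polyfun_cst I (-1)) hf)) => u.
by rewrite mulN1r.
Qed.

Lemma fin_uniform (J : finType) (Q : J -> nat -> Prop) :
  (forall j e e', (e <= e')%N -> Q j e -> Q j e') ->
  (forall j, exists e, Q j e) -> exists e, forall j, Q j e.
Proof.
move=> Qmono /fin_all_exists [e he]; exists (\max_j e j) => j.
exact: Qmono (leq_bigmax j) (he j).
Qed.

Lemma polyfun_sum I (J : finType) (P : pred J) (f : J -> {ffun I -> k} -> k) :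
  (forall j, polyfun (f j)) -> polyfun (fun u => \sum_(j | P j) f j u).
Proof.
move=> /fin_uniform[|e he]; last by exists e; apply: polydeg_sum.
by move=> j e e' le; apply: polydegW.
Qed.

Lemma polyfun_prod I (J : finType) (f : J -> {ffun I -> k} -> k) :
  (forall j, polyfun (f j)) -> polyfun (fun u => \prod_j f j u).
Proof.
move=> /fin_uniform[|e he]; last by exists (#|J| * e)%N; apply: polydeg_prod.
by move=> j e e' le; apply: polydegW.
Qed.

Lemma polyfun_det I m (A : {ffun I -> k} -> 'M[k]_m) :
  (forall i j, polyfun (fun u => A u i j)) -> polyfun (fun u => \det (A u)).
Proof.
move=> hA; rewrite /determinant; apply: polyfun_sum => s.
by apply: polyfunM; [apply: polyfun_cst | apply: polyfun_prod].
Qed.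

Lemma polyfun_adj I m (A : {ffun I -> k} -> 'M[k]_m) i j :
  (forall i j, polyfun (fun u => A u i j)) -> polyfun (fun u => (\adj (A u)) i j).
Proof.
move=> hA.
have h : polyfun (fun u => cofactor (A u) j i).
  rewrite /cofactor; apply: polyfunM; first exact: polyfun_cst.
  apply: polyfun_det => i' j'.
  by apply: (eq_polyfun _ (hA (lift j i') (lift i j'))) => u; rewrite !mxE.
by apply: (eq_polyfun _ h) => u; rewrite mxE.
Qed.

Hypothesis natk_inj : injective (fun m : nat => m%:R : k).

Lemma poly_nonroot (p : {poly k}) : p != 0 -> exists z, p.[z] != 0.
Proof.
move=> p0; pose s := [seq i%:R : k | i <- iota 0 (size p)].
have us : uniq s by rewrite map_inj_uniq ?iota_uniq.
case: (boolP (all (root p) s)) => [h|/allPn[z _ hz]]; last by exists z.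
by have := max_poly_roots p0 h us; rewrite size_map size_iota ltnn.
Qed.

Lemma poly_eq0_nat (p : {poly k}) m :
  (size p <= m.+1)%N -> (forall j, (j <= m)%N -> p.[j%:R] = 0) -> p = 0.
Proof.
move=> sp hp; apply/eqP; apply: contraT => p0.
pose s := [seq i%:R : k | i <- iota 0 m.+1].
have us : uniq s by rewrite map_inj_uniq ?iota_uniq.
have h : all (root p) s.
  apply/allP => z /mapP[j]; rewrite mem_iota => hj ->.
  by apply/eqP; apply: hp; lia.
by have := max_poly_roots p0 h us; rewrite size_map size_iota ltnNge sp.
Qed.

Definition natpt I m (y : {ffun I -> 'I_m}) : {ffun I -> k} := [ffun i => (y i)%:R].

(** On a line in a coordinate direction, e+1 zeros kill f. So the coordinates can be freed one at a
    time; in [H], the list [s] contains the free ones. *)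
Lemma polydeg_vanish I (B : {set I}) e (f : {ffun I -> k} -> k) :
  polydeg e f ->
  (forall y : {ffun I -> 'I_e.+1}, y \in pffun_on ord0 B predT -> f (natpt y) = 0) ->
  forall u : {ffun I -> k}, (forall i, i \notin B -> u i = 0) -> f u = 0.
Proof.
move=> hf hy.
have H (s : seq I) : forall u : {ffun I -> k}, (forall i, i \notin B -> u i = 0) ->
    (forall i, i \notin s -> exists2 j, (j <= e)%N & u i = j%:R) -> f u = 0.
  elim: s => [|i s IH] u uB us.
    have /fin_all_exists[y hyu] : forall i, exists j : 'I_e.+1, u i = j%:R.
      move=> i; have [//|j le ->] := us i.
      by exists (Ordinal (le : (j < e.+1)%N)).
    have -> : u = natpt [ffun i => y i] by apply/ffunP => i; rewrite !ffunE.
    apply: hy; apply/pffun_onP; split => [|x //].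
    apply/subsetP => i; rewrite inE ffunE; apply: contraNT => iB.
    by apply/eqP/val_inj/natk_inj; rewrite /= -hyu uB.
  case: (boolP (i \in B)) => iB; last first.
    apply: IH => // j js; case: (eqVneq j i) => [->|ji]; first by exists 0%N; rewrite ?uB.
    by apply: us; rewrite inE negb_or ji.
  pose x : {ffun I -> k} := [ffun j => if j == i then 0 else u j].
  pose d : {ffun I -> k} := [ffun j => (j == i)%:R].
  case: (hf x d) => p sp hp.
  have p0 : p = 0.
    apply: poly_eq0_nat sp _ => m le; rewrite -hp; apply: IH => j hj.
      rewrite !ffunE; case: eqP => [ji|_]; first by rewrite ji iB in hj.
      by rewrite mulr0 addr0 uB.
    rewrite !ffunE; case: eqP => [_|/eqP ji].
      by exists m; rewrite ?add0r ?mulr1.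
    by rewrite mulr0 addr0; apply: us; rewrite inE negb_or ji.
  have -> : u = line x d (u i).
    apply/ffunP => j; rewrite !ffunE; case: eqP => [->|_].
      by rewrite add0r mulr1.
    by rewrite mulr0 addr0.
  by rewrite hp p0 horner0.
move=> u uB; apply: (H (enum I)) => // i; by rewrite mem_enum.
Qed.

Lemma linear_relation (G C : finType) (P : {pred C}) (M : G -> C -> k) :
  (#|P| < #|G|)%N ->
  exists2 g : G -> k, (exists x, g x != 0) &
    forall c, c \in P -> \sum_x g x * M x c = 0.
Proof.
move=> lt; pose A := \matrix_(i < #|G|, j < #|P|) M (enum_val i) (enum_val j).
have K0 : kermx A != 0.
  rewrite -mxrank_eq0 mxrank_ker -lt0n subn_gt0.
  exact: leq_ltn_trans (rank_leq_col _) lt.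
pose v := nz_row (kermx A).
have v0 : v != 0 by rewrite nz_row_eq0.
have vA : v *m A = 0 by apply/sub_kermxP; apply: nz_row_sub.
exists (fun x => v 0 (enum_rank x)).
  case/rV0Pn: v0 => i hi; exists (enum_val i); by rewrite enum_valK.
move=> c cP; have /rowP/(_ (enum_rank_in cP c)) := vA.
rewrite !mxE => h; apply: etrans h; rewrite (reindex (@enum_val G predT)) /=; last first.
  by exists enum_rank => x _; rewrite ?enum_valK ?enum_rankK.
by apply: eq_bigr => i _; rewrite enum_valK !mxE (enum_rankK_in cP).
Qed.

Lemma prod_natpoly_size (m : nat) (j : 'I_m) :
  (size (\prod_(l < m | l != j) ('X - (l%:R : k)%:P))%R <= m)%N.
Proof.
rewrite -big_filter size_prod_XsubC.
have /perm_size -> : perm_eq [seq x <- index_enum 'I_m | x != j] (rem j (index_enum 'I_m)).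
  by rewrite (rem_filter _ (index_enum_uniq _)).
rewrite size_rem ?mem_index_enum // -sum1_size sum1_card card_ord.
by case: m j => [[]|].
Qed.

(* Interpolating polynomials on the grid {0, ..., m-1}^A form a space of
   dimension m ^ #|A|, whereas vanishing on the images costs
   O(m ^ (#|A| - 1)) linear conditions. *)
Lemma images_in_hypersurface (A Sg B : finType) (act : Sg -> {set B})
    (Psi : Sg -> {ffun B -> k} -> A -> k) :
  (forall s a, polyfun (fun u => Psi s u a)) ->
  (forall s, (#|act s| < #|A|)%N) -> (0 < #|A|)%N ->
  exists2 F : {ffun A -> k} -> k, polyfun F & (exists x, F x != 0) /\
    forall s (u : {ffun B -> k}), (forall b, b \notin act s -> u b = 0) ->
      F [ffun a => Psi s u a] = 0.
Proof.
move=> hPsi hact A0.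
have [c0 hc0] : exists e, forall sa : Sg * A, polydeg e (fun u => Psi sa.1 u sa.2).
  apply: fin_uniform => [sa e e' le|[s a]]; first exact: polydegW.
  exact: hPsi.
(* [F] will have [m ^ a] coefficients. Composed with [Psi s] it has degree at most [E], so its
   vanishing on stratum [s] costs at most [E.+1 ^ a.-1] equations. As [E.+1 <= (a * c0).+1 * m], all
   strata together cost at most [K * m ^ a.-1], which is less than [m ^ a]. *)
pose a := #|A|; pose K := (#|Sg| * (a * c0).+1 ^ a.-1)%N.
pose m := K.+1; pose E := (a * (K * c0))%N.
(* Lagrange polynomials without their denominators: [L y] is nonzero at the grid point [y] and zero
   at the others, so a nontrivial combination of them is a nonzero function. *)
pose ell (j : 'I_m) : {poly k} := \prod_(l < m | l != j) ('X - (l%:R : k)%:P).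
pose L (y : {ffun A -> 'I_m}) (x : {ffun A -> k}) := \prod_b (ell (y b)).[x b].
have sell j : (size (ell j) <= K.+1)%N by apply: prod_natpoly_size.
pose C : finType := (Sg * {ffun B -> 'I_E.+1})%type.
pose P : {pred C} := [pred c | c.2 \in pffun_on ord0 (act c.1) predT].
pose M y (c : C) := L y [ffun b => Psi c.1 (natpt c.2) b].
have [|g [y0 gy0] hg] := @linear_relation _ _ P M.
  rewrite card_ffun card_ord -/a.
  have -> : #|P| = (\sum_s E.+1 ^ #|act s|)%N.
    rewrite -sum1_card (eq_bigl (fun c => true && (c.2 \in pffun_on ord0 (act c.1) predT))) //.
    rewrite -(pair_big_dep xpredT (fun s y => y \in pffun_on ord0 (act s) predT)
               (fun _ _ => 1%N)) /=.
    apply: eq_bigr => s _; rewrite sum1_card card_pffun_on.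
    by rewrite -[in RHS](card_ord E.+1).
  have lt1 : (\sum_s E.+1 ^ #|act s| <= #|Sg| * E.+1 ^ a.-1)%N.
    rewrite -sum_nat_const; apply: leq_sum => s _.
    by apply: leq_pexp2l => //; have := hact s; rewrite -/a; lia.
  apply: leq_ltn_trans lt1 _.
  have lt2 : (E.+1 <= (a * c0).+1 * m)%N.
    by rewrite /E /m; nia.
  have aE : a = a.-1.+1 by rewrite prednK.
  rewrite [in X in (_ < X)%N]aE expnS.
  have le3 : (E.+1 ^ a.-1 <= (a * c0).+1 ^ a.-1 * m ^ a.-1)%N.
    by rewrite -expnMn; case: a.-1 => [//|j]; rewrite leq_exp2r.
  have m1 : (0 < m ^ a.-1)%N by rewrite expn_gt0.
  have : (#|Sg| * E.+1 ^ a.-1 <= K * m ^ a.-1)%N by rewrite /K -mulnA leq_mul.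
  rewrite /m in m1 *; nia.
pose F x := \sum_y g y * L y x.
exists F.
  apply: polyfun_sum => y; apply: polyfunM; first exact: polyfun_cst.
  apply: polyfun_prod => b; exists (K * 1)%N.
  by apply: polydeg_horner => //; apply: polydeg_coord.
split.
  exists (natpt y0); rewrite /F (bigD1 y0) //= big1 => [|y /eqP yy0].
    rewrite addr0 mulf_neq0 //; apply/prodf_neq0 => b _.
    rewrite ffunE horner_prod; apply/prodf_neq0 => l lb.
    rewrite !hornerE subr_eq0; apply: contra lb => /eqP/natk_inj h.
    by apply/eqP/val_inj.
  have [b hb] : exists b, y b != y0 b.
    apply/existsP; apply: contraT; rewrite negb_exists => /forallP h.
    by case: yy0; apply/ffunP => b; apply/eqP; have := h b; rewrite negbK.
  have e0 : (ell (y b)).[(y0 b)%:R] = 0.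
    by apply/eqP; rewrite horner_prod prodf_seq_eq0; apply/hasP;
      exists (y0 b); rewrite ?mem_index_enum // eq_sym hb !hornerE subrr eqxx.
  by rewrite /L (bigD1 b) //= ffunE e0 mul0r mulr0.
move=> s; pose f u := F [ffun b => Psi s u b].
apply: (@polydeg_vanish _ (act s) E f).
  apply: polydeg_sum => y.
  rewrite -[E]add0n; apply: polydegM; first exact: polydeg_cst.
  have := @polydeg_prod B A (K * c0) (fun b u => (ell (y b)).[Psi s u b]) _.
  move/(_ (fun b => polydeg_horner (sell (y b)) (hc0 (s, b)))).
  by apply: eq_polydeg => u; apply: eq_bigr => b _; rewrite ffunE.
by move=> y hy; apply: (hg (s, y)).
Qed.

End PolynomialFunctions.

(** * Generic properties *)

Section Generic.
Variable k : fieldType.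
Hypothesis natk_inj : injective (fun m : nat => m%:R : k).

Definition generic (I : finType) (Q : {ffun I -> k} -> Prop) : Prop :=
  exists2 f : {ffun I -> k} -> k, polyfun f &
    (exists x, f x != 0) /\ forall x, f x != 0 -> Q x.

(** On the line joining a nonzero of f to a nonzero of g, both restrict to nonzero polynomials of
    one variable, whose product has a nonroot. *)
Lemma generic_and (I : finType) (Q1 Q2 : {ffun I -> k} -> Prop) :
  generic Q1 -> generic Q2 -> generic (fun x => Q1 x /\ Q2 x).
Proof.
move=> [f pf [[x fx] hf]] [g pg [[y gy] hg]].
exists (fun u => f u * g u); first exact: polyfunM.
split=> [|u]; last by rewrite mulf_eq0 negb_or => /andP[/hf ? /hg].
case: pf => e /(_ x [ffun i => y i - x i])[p _ hp].
case: pg => e' /(_ x [ffun i => y i - x i])[q _ hq].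
have l0 : line x [ffun i => y i - x i] 0 = x.
  by apply/ffunP => i; rewrite !ffunE mul0r addr0.
have l1 : line x [ffun i => y i - x i] 1 = y.
  by apply/ffunP => i; rewrite !ffunE mul1r addrC subrK.
have p0 : p != 0 by apply: contraNneq fx => p0; rewrite -l0 hp p0 horner0.
have q0 : q != 0 by apply: contraNneq gy => q0; rewrite -l1 hq q0 horner0.
have [z hz] := poly_nonroot natk_inj (mulf_neq0 p0 q0).
by exists (line x [ffun i => y i - x i] z); rewrite hp hq -hornerM.
Qed.

Lemma generic_imp (I : finType) (Q1 Q2 : {ffun I -> k} -> Prop) :
  (forall x, Q1 x -> Q2 x) -> generic Q1 -> generic Q2.
Proof. by move=> h [f pf [fx hf]]; exists f => //; split=> // x /hf/h. Qed.

Lemma generic_ex (I : finType) (Q : {ffun I -> k} -> Prop) :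
  generic Q -> exists x, Q x.
Proof. by move=> [f _ [[x fx] hf]]; exists x; apply: hf. Qed.

End Generic.

(** * Linear algebra *)

Section BlockDiagonal.
Variable F : fieldType.

Definition bdiag (a l d : nat) (T : 'M[F]_(l, d)) :=
  \mxblock_(i < a, j < a) (if i == j then T else 0).

Lemma mul_bdiag_mxblock a b l d d' (T : 'M[F]_(l, d)) (B : 'I_a -> 'I_b -> 'M[F]_(d, d')) :
  bdiag a T *m \mxblock_(i, j) B i j = \mxblock_(i, j) (T *m B i j).
Proof.
rewrite mul_mxblock; apply: eq_mxblock => i j.
rewrite (bigD1 i) //= eqxx big1 ?addr0 // => l' /negbTE.
by rewrite eq_sym => ->; rewrite mul0mx.
Qed.

Lemma mul_mxblock_bdiag a b l d d' (T : 'M[F]_(l, d)) (B : 'I_b -> 'I_a -> 'M[F]_(d', l)) :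
  \mxblock_(i, j) B i j *m bdiag a T = \mxblock_(i, j) (B i j *m T).
Proof.
rewrite mul_mxblock; apply: eq_mxblock => i j.
rewrite (bigD1 j) //= eqxx big1 ?addr0 // => l' /negbTE ->.
by rewrite mulmx0.
Qed.

Lemma mul_bdiag a l d d' (T : 'M[F]_(l, d)) (S : 'M[F]_(d, d')) :
  bdiag a T *m bdiag a S = bdiag a (T *m S).
Proof.
rewrite mul_bdiag_mxblock; apply: eq_mxblock => i j.
by case: eqP => //; rewrite mulmx0.
Qed.

Lemma bdiagD a l d (T S : 'M[F]_(l, d)) : bdiag a (T + S) = bdiag a T + bdiag a S.
Proof.
rewrite -mxblockD; apply: eq_mxblock => i j.
by case: eqP => //; rewrite addr0.
Qed.

Lemma bdiag1 a l : bdiag a (1%:M : 'M[F]_l) = 1%:M.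
Proof.
rewrite -[RHS]mxdiagZ; apply: eq_mxblock => i j.
by case: eqP => // _; rewrite conform_mx_id.
Qed.

Lemma mxdiag_bdiag a l d (T : 'M[F]_(l, d)) (V : 'I_a -> 'M[F]_l) :
  (\mxdiag_i V i) *m bdiag a T = \mxblock_(i, j) (if i == j then V i *m T else 0).
Proof.
rewrite mul_mxdiag_mxblock; apply: eq_mxblock => i j.
by case: eqP => //; rewrite mulmx0.
Qed.

Lemma bdiag_mxdiag a l d (T : 'M[F]_(l, d)) (V : 'I_a -> 'M[F]_d) :
  bdiag a T *m (\mxdiag_i V i) = \mxblock_(i, j) (if i == j then T *m V i else 0).
Proof.
rewrite mul_mxblock_mxdiag; apply: eq_mxblock => i j.
by case: eqP => [->|] //; rewrite mul0mx.
Qed.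

(* Left exactness of Hom(coker d, -). *)
Lemma rank_ker_exact (dL d dQ bL b bQ : nat)
    (WL : 'M[F]_dL) (W : 'M[F]_d) (WQ : 'M[F]_dQ)
    (PL : 'M[F]_(dL, bL)) (P : 'M[F]_(d, b)) (PQ : 'M[F]_(dQ, bQ))
    (S : 'M[F]_(dL, d)) (S' : 'M[F]_(bL, b)) (S2 : 'M[F]_(d, dQ)) (S2' : 'M[F]_(b, bQ)) :
  row_free S -> row_free S' -> (kermx S2 <= S)%MS -> W *m W = W ->
  WL *m S = S *m W -> W *m S2 = S2 *m WQ ->
  PL *m S' = S *m P -> P *m S2' = S2 *m PQ ->
  (\rank (W :&: kermx P) <= \rank (WL :&: kermx PL) + \rank (WQ :&: kermx PQ))%N.
Proof.
move=> freeS freeS' kS WW WLS WS PLS PS; set K := (W :&: kermx P)%MS.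
rewrite -(mxrank_mul_ker K S2) addnC; apply: leq_add.
  set Z := (K :&: kermx S2)%MS.
  have ZS : (Z <= S)%MS by apply: submx_trans kS; apply: capmxSr.
  have ZK : (Z <= K)%MS by apply: capmxSl.
  have ZW : Z *m W = Z.
    have /submxP[Y ->] : (Z <= W)%MS by apply: submx_trans ZK (capmxSl _ _).
    by rewrite -mulmxA WW.
  have ZP : Z *m P = 0.
    by apply/sub_kermxP; apply: submx_trans ZK (capmxSr _ _).
  clearbody Z; case/submxP: ZS => Y hY.
  have YW : Y *m WL = Y.
    by apply: (row_free_inj freeS); rewrite -mulmxA WLS mulmxA -hY ZW.
  have YP : Y *m PL = 0.
    by apply: (row_free_inj freeS'); rewrite -mulmxA PLS mulmxA -hY ZP mul0mx.
  apply: leq_trans (mxrankS (_ : Z <= (WL :&: kermx PL)%MS *m S)%MS) (mxrankM_maxl _ _).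
  rewrite hY; apply: submxMr; rewrite sub_capmx; apply/andP; split.
    by rewrite -YW submxMl.
  exact/sub_kermxP.
apply: mxrankS; rewrite sub_capmx; apply/andP; split.
  apply: submx_trans (submxMr _ (capmxSl _ _)) _.
  by rewrite WS submxMl.
apply/sub_kermxP; rewrite -mulmxA -PS mulmxA.
have -> : K *m P = 0 by apply/sub_kermxP; apply: capmxSr.
by rewrite mul0mx.
Qed.

(** Cancelling both factors of the full-rank factorisation of [Pi] in [Pi *m Pi = Pi]. This provides
    the projection to M/L and a section of it. *)
Lemma idempotent_split d (Pi : 'M[F]_d) :
  Pi *m Pi = Pi -> row_base Pi *m col_base Pi = 1%:M.
Proof.
move=> idP; have := idP; rewrite -{1 2 3}(mulmx_base Pi) mulmxA -[X in X *m _ = _]mulmxA.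
move=> /(row_free_inj (row_base_free Pi)) h.
have colfree : row_free (col_base Pi)^T.
  by rewrite /row_free mxrank_tr; apply: col_base_full.
apply: trmx_inj; apply: (row_free_inj colfree).
by rewrite -!trmx_mul mulmx1 h.
Qed.

End BlockDiagonal.

Section LinearAlgebra.
Variable k : fieldType.

(** A subspace of dimension at least h projects onto some h coordinates. Applied to the space of all
    phi with phi d = 0, it says which entries of phi can be prescribed. *)
Lemma kernel_coordinates (N h : nat) (K : 'M[k]_N) : (h <= \rank K)%N ->
  exists f : 'I_h -> 'I_N, forall s : 'I_h -> k,
    exists2 z : 'rV[k]_N, (z <= K)%MS & forall i, z 0 (f i) = s i.
Proof.
move=> hr; have full : row_full (row_base K)^T.
  by rewrite /row_full mxrank_tr; apply: row_base_free.
pose fr := fullrankfun full; pose M := rowsub fr (row_base K)^T.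
have uM : M^T \in unitmx by rewrite unitmx_tr -row_full_unit fullrowsub_full.
exists (fun i => fr (widen_ord hr i)) => s.
pose s' : 'rV_(\rank K) := (\row_i s i) *m pid_mx h.
exists (s' *m invmx M^T *m row_base K).
  by rewrite -(eq_row_base K) submxMl.
move=> i; have -> : (s' *m invmx M^T *m row_base K) 0 (fr (widen_ord hr i)) =
    (s' *m invmx M^T *m M^T) 0 (widen_ord hr i).
  by rewrite !mxE; apply: eq_bigr => j _; rewrite !mxE.
rewrite mulmxKV // mxE (bigD1 i) //= !mxE eqxx ltn_ord mulr1 big1 ?addr0 // => j ji.
by rewrite !mxE /= (negbTE (ji : val j != val i)) mulr0.
Qed.

Variable D : nat.

(* The nonzero rows are the first \rank A ones, and form a basis of A. *)
Definition stdbase (A : 'M[k]_D) : 'M[k]_D := pid_mx (\rank A) *m row_ebase A.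

(** Coordinates in [stdbase A], padded with zeros to length D, so that the shape of the parameters
    does not depend on the rank. *)
Definition coords m (A : 'M[k]_D) (x : 'M[k]_(m, D)) : 'M[k]_(m, D) :=
  x *m invmx (row_ebase A) *m pid_mx (\rank A).

Lemma coordsK m (A : 'M[k]_D) (x : 'M[k]_(m, D)) :
  (x <= A)%MS -> coords A x *m stdbase A = x.
Proof.
case/submxP=> z hz; rewrite /coords /stdbase.
have -> : x = z *m col_ebase A *m pid_mx (\rank A) *m row_ebase A.
  by rewrite hz -{1}(mulmx_ebase A) !mulmxA.
rewrite mulmxK ?row_ebase_unit // !mulmxA; congr (_ *m _).
by rewrite -!mulmxA !pid_mx_id ?rank_leq_row.
Qed.

Lemma stdbase_sub (A : 'M[k]_D) : (stdbase A <= A)%MS.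
Proof.
apply/submxP; exists (invmx (col_ebase A)).
by rewrite -{3}(mulmx_ebase A) !mulmxA mulVmx ?col_ebase_unit // mul1mx.
Qed.

Lemma coords_pid m (A : 'M[k]_D) (x : 'M[k]_(m, D)) :
  coords A x *m pid_mx (\rank A) = coords A x.
Proof. by rewrite /coords -mulmxA pid_mx_id ?rank_leq_row. Qed.

Lemma stdbase_inj m (A : 'M[k]_D) (x : 'M[k]_(m, D)) :
  x *m pid_mx (\rank A) = x -> x *m stdbase A = 0 -> x = 0.
Proof.
move=> hx; rewrite /stdbase mulmxA hx => h.
by rewrite -(mulmxK (row_ebase_unit A) x) h mul0mx.
Qed.

Variable T : finType.

(** Unselected rows are filled with unit vectors: when the [Z x] live in the first l coordinates and
    the first l rows are selected, a determinant of size D tests whether these rows are a basis. *)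
Definition selected (sel : 'I_D -> option T) (Z : T -> 'rV[k]_D) : 'M[k]_D :=
  \matrix_r oapp Z (delta_mx 0 r) (sel r).

Lemma select_rows (Z : T -> 'rV[k]_D) (l : nat) :
  (forall x, Z x *m pid_mx l = Z x) ->
  (l <= \rank (\matrix_(i < #|T|) Z (enum_val i)))%N ->
  exists sel : {ffun 'I_D -> option T},
    [/\ forall r, (sel r != None) = (r < l)%N,
        forall r r' x, sel r = Some x -> sel r' = Some x -> r = r'
      & \det (selected sel Z) != 0].
Proof.
move=> hZ; set M := \matrix_i _ => lM.
have Ml : (\rank M <= l)%N.
  have -> : M = M *m pid_mx l by apply/row_matrixP => i; rewrite row_mul rowK hZ.
  apply: leq_trans (mxrankM_maxr _ _) _.
  case: (leqP l D) => h; first by rewrite rank_pid_mx.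
  exact: leq_trans (rank_leq_col _) (ltnW h).
have {lM Ml} el : l = \rank M by apply/eqP; rewrite eqn_leq lM.
subst l; pose f := maxrankfun M.
pose sel := [ffun r : 'I_D => omap (fun i => enum_val (f i)) (insub (val r) : option 'I_(\rank M))].
have selN (r : 'I_D) : (\rank M <= r)%N -> sel r = None.
  by move=> h; rewrite ffunE insubF // ltnNge h.
have selS (r : 'I_D) (h : (r < \rank M)%N) : sel r = Some (enum_val (f (Ordinal h))).
  by rewrite ffunE insubT.
exists sel; split.
- move=> r; case: (ltnP r (\rank M)) => h; first by rewrite selS.
  by rewrite selN.
- move=> r r' x; case: (ltnP r (\rank M)) => h; last by rewrite selN.
  case: (ltnP r' (\rank M)) => h'; last by rewrite (selN r').
  rewrite !selS => -[<-] [/enum_val_inj/maxrankfun_inj/(congr1 val) /= e].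
  exact/esym/val_inj.
rewrite -unitfE -[_ \is a _]/(_ \in unitmx) -row_free_unit -kermx_eq0.
apply/eqP/row_matrixP => i; rewrite row0; set x := row i _.
have hx : x *m selected sel Z = 0 by rewrite -row_mul mulmx_ker row0.
clearbody x; clear i.
have hsum : \sum_r x 0 r *: oapp Z (delta_mx 0 r) (sel r) = 0.
  apply: etrans hx; rewrite mulmx_sum_row; apply: eq_bigr => r _; by rewrite rowK.
(* Every [Z x] vanishes in column r, so only the unit vector of row r contributes there. *)
have xN (r : 'I_D) : (\rank M <= r)%N -> x 0 r = 0.
  move=> hr; move/rowP: hsum => /(_ r); rewrite summxE mxE (bigD1 r) //= selN //= !mxE !eqxx mulr1.
  rewrite big1 ?addr0 // => r' rr'; rewrite mxE; case: (sel r') => [y|] /=.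
    rewrite -hZ mxE big1 ?mulr0 // => s _; rewrite mxE.
    case: eqP => [->|]; last by rewrite mulr0.
    by rewrite ltnNge hr mulr0.
  by rewrite mxE eq_sym (negbTE rr') andbF mulr0.
have leD : (\rank M <= D)%N by apply: rank_leq_col.
pose x' : 'rV_(\rank M) := \row_i x 0 (widen_ord leD i).
have x'0 : x' = 0.
  apply: (row_free_inj (maxrowsub_free M)); rewrite mul0mx -[RHS]hsum mulmx_sum_row.
  rewrite [RHS](bigID (fun r : 'I_D => (r < \rank M)%N)) /= [X in _ + X]big1 ?addr0; last first.
    by move=> r; rewrite -leqNgt => hr; rewrite xN ?scale0r.
  rewrite (big_ord_narrow leD); apply: eq_bigr => i _.
  rewrite mxE row_rowsub rowK (@selS (widen_ord leD i) (ltn_ord i)) /=.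
  by congr (_ *: Z (enum_val (f _))); apply: val_inj.
apply/rowP => r; rewrite mxE; case: (ltnP r (\rank M)) => hr; last exact: xN.
move/rowP: x'0 => /(_ (Ordinal hr)); rewrite !mxE => <-.
by congr (x 0 _); apply: val_inj.
Qed.

(* Cramer's rule: the relations among the Z x are polynomial in Z and in the
   values y taken off the selected rows. *)
Lemma relation_param (Z : T -> 'rV[k]_D) (sel : 'I_D -> option T) (t : T -> k) :
  (forall r r' x, sel r = Some x -> sel r' = Some x -> r = r') ->
  \det (selected sel Z) != 0 -> \sum_x t x *: Z x = 0 ->
  exists2 y : T -> k, (forall x, (exists r, sel r = Some x) -> y x = 0) &
    forall x, t x = y x * \det (selected sel Z) -
      \sum_(r | sel r == Some x) ((\sum_x' y x' *: Z x') *m \adj (selected sel Z)) 0 r.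
Proof.
move=> inj d0 ht; set A := selected sel Z in d0 *; set dt := \det A in d0 *.
pose hit x := [exists r, sel r == Some x].
(* Dividing by [dt] here lets the formula for t use the adjugate instead of the inverse, hence no
   denominators. *)
pose y x := if hit x then 0 else t x / dt.
exists y => [x [r hr]|x].
  by rewrite /y ifT //; apply/existsP; exists r; rewrite hr.
pose tau : 'rV[k]_D := \row_r oapp t 0 (sel r).
have tauA : tau *m A = \sum_(x | hit x) t x *: Z x.
  rewrite mulmx_sum_row (bigID (fun r => sel r == None)) /= big1 ?add0r; last first.
    by move=> r /eqP hr; rewrite mxE hr scale0r.
  rewrite (eq_bigr (fun r => \sum_(x | sel r == Some x) t x *: Z x)); last first.
    move=> r; case hr: (sel r) => [x0|//] _.
    by rewrite (big_pred1 x0) ?mxE ?rowK ?hr //= => x'; rewrite eq_sym.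
  rewrite (exchange_big_dep hit) /=; last first.
    by move=> r x' _ hr; apply/existsP; exists r.
  apply: eq_bigr => x' /existsP[r /eqP hr]; rewrite (big_pred1 r) // => r' /=.
  apply/andP/eqP => [[_ /eqP hr']|->]; first exact: inj hr' hr.
  by rewrite hr.
have taud : dt *: tau = - (dt *: ((\sum_x' y x' *: Z x') *m \adj A)).
  have -> : dt *: tau = tau *m A *m \adj A by rewrite -mulmxA mul_mx_adj mul_mx_scalar.
  rewrite tauA; move/eqP: ht; rewrite (bigID hit) /= addr_eq0 => /eqP ->.
  rewrite mulNmx scalemxAl scaler_sumr; congr (- (_ *m _)).
  rewrite [RHS](bigID hit) /= [X in _ = X + _]big1 ?add0r => [|x' hx]; last first.
    by rewrite /y hx scale0r scaler0.
  apply: eq_bigr => x' hx; rewrite /y (negbTE hx) scalerA mulrC divfK //.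
have tauE : tau = - ((\sum_x' y x' *: Z x') *m \adj A).
  by apply: (scalerI d0); rewrite taud scalerN.
case: (boolP (hit x)) => hx.
  rewrite /y hx mul0r add0r -/y; case/existsP: (hx) => r /eqP hr.
  rewrite (big_pred1 r) => [|r' /=]; last first.
    by apply/eqP/eqP => [h|->] //; apply: inj h hr.
  by move/rowP: tauE => /(_ r); rewrite !mxE hr.
rewrite big_pred0 => [|r]; first by rewrite subr0 /y (negbTE hx) divfK.
by apply: contraNF hx => h; apply/existsP; exists r.
Qed.

End LinearAlgebra.

(** * General presentations *)

Section Modules.
Variable k : fieldType.
Hypothesis natk_inj : injective (fun m : nat => m%:R : k).
Variables (n P : nat) (c : 'I_P -> 'I_P -> 'I_P -> k) (beta : 'I_n -> 'I_P -> k).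

Definition videm D (Y : 'I_P -> 'M[k]_D) (v : 'I_n) : 'M[k]_D :=
  \sum_q beta v q *: Y q.

(* A module over the algebra with basis elements of structure constants c, in
   which the idempotent e_v is the combination beta v of the basis. *)
Definition is_module D (Y : 'I_P -> 'M[k]_D) : Prop :=
  (forall p q, Y p *m Y q = \sum_r c p q r *: Y r) /\
  (forall v, videm Y v *m videm Y v = videm Y v).

Definition stable D (Y : 'I_P -> 'M[k]_D) (U : 'M[k]_D) : Prop :=
  forall p, (U *m Y p <= U)%MS.

Definition ldim D (Y : 'I_P -> 'M[k]_D) (U : 'M[k]_D) (v : 'I_n) : nat :=
  \rank (U *m videm Y v).

Lemma submx_videm D (Y : 'I_P -> 'M[k]_D) m m' (x : 'M[k]_(m, D)) (U : 'M[k]_(m', D)) v :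
  (forall p, (x *m Y p <= U)%MS) -> (x *m videm Y v <= U)%MS.
Proof.
move=> h; rewrite /videm mulmx_sumr; apply: summx_sub => q _.
by rewrite -scalemxAr scalemx_sub.
Qed.

Section Presentation.
Variables (a b : nat) (vp : 'I_a -> 'I_n) (vm : 'I_b -> 'I_n).
Local Notation T := ('I_a * 'I_P)%type.

Definition pblock D (Y : 'I_P -> 'M[k]_D) (t : {ffun 'I_b * T -> k}) j i : 'M[k]_D :=
  \sum_p t (i, (j, p)) *: (videm Y (vp j) *m Y p *m videm Y (vm i)).

Definition pdom D (Y : 'I_P -> 'M[k]_D) := \mxdiag_(j < a) videm Y (vp j).

Definition pmap D (Y : 'I_P -> 'M[k]_D) t := \mxblock_(j < a, i < b) pblock Y t j i.

(* dim Hom(coker d, M), where t lists the coefficients of d on the basis. *)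
Definition hdim D (Y : 'I_P -> 'M[k]_D) t : nat :=
  \rank (pdom Y :&: kermx (pmap Y t))%MS.

(** For fixed phi, the condition phi d = 0 is linear in d: for each summand of P_- it is one
    relation among the vectors phi_j Y_p e_v. These are the relations to be solved by Cramer's
    rule. *)
Lemma kernel_rows D (Y : 'I_P -> 'M[k]_D) t (z : 'rV[k]_(\sum_(j < a) D)) :
  is_module Y -> (z <= pdom Y :&: kermx (pmap Y t))%MS ->
  (forall j, submxrow z j *m videm Y (vp j) = submxrow z j) /\
  (forall i, \sum_(x : T) t (i, x) *: (submxrow z x.1 *m Y x.2 *m videm Y (vm i)) = 0).
Proof.
move=> [_ idE]; rewrite sub_capmx => /andP[/submxP[y hy] /sub_kermxP hz].
have zE j : submxrow z j *m videm Y (vp j) = submxrow z j.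
  have := hy; rewrite -[y]submxrowK mul_mxrow_mxdiag => ->.
  by rewrite mxrowK -mulmxA idE.
split=> // i.
have := hz; rewrite -[z in z *m _]submxrowK mul_mxrow_mxblock => /(congr1 (fun z => submxrow z i)).
rewrite mxrowK submxrow0 => hi; apply: etrans hi.
transitivity (\sum_j \sum_p t (i, (j, p)) *: (submxrow z j *m Y p *m videm Y (vm i))).
  by rewrite pair_bigA; apply: eq_bigr => -[j p].
apply: eq_bigr => j _; rewrite mulmx_sumr; apply: eq_bigr => p _.
by rewrite -scalemxAr !mulmxA zE.
Qed.

(** * Parameter count for pairs (d, phi) *)

Section Dimension.
Variables (D : nat) (Y : 'I_P -> 'M[k]_D) (h : nat).

Local Notation Cv := ('I_n * 'I_D * 'I_D + 'I_n * 'I_P * 'I_n * ('I_D * 'I_D))%type.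
Local Notation Bv := (Cv + 'I_a * 'I_D + 'I_b * T)%type.
Local Notation Av := ('I_b * T + 'I_h)%type.
Local Notation Sg := (option bool * {ffun 'I_n * 'I_D -> option T} * {ffun 'I_h -> 'I_a * 'I_D})%type.

(* Parameters of a pair (d, phi) whose phi has image L: a basis of each L e_v and
   the matrices of the algebra on it (Cv), the coordinates of phi in this basis,
   and the entries of d away from the selected rows.  The discrete datum s says
   whether L is 0 (Some false), M (Some true) or unrestricted (None), which rows
   are selected, and which h entries of phi are prescribed. *)
Definition param_count : nat := #|{: Cv}|.

Definition basis_of (U : 'M[k]_D) v : 'M[k]_D := stdbase (U *m videm Y v).

Definition action_of (U : 'M[k]_D) w p v : 'M[k]_D :=
  coords (U *m videm Y v) (basis_of U w *m Y p *m videm Y v).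

Definition par_basis (s : Sg) (u : {ffun Bv -> k}) v : 'M[k]_D :=
  if s.1.1 is Some e then basis_of (e%:R%:M) v
  else \matrix_(r, x) u (inl (inl (inl (v, r, x)))).

Definition par_action (s : Sg) (u : {ffun Bv -> k}) w p v : 'M[k]_D :=
  if s.1.1 is Some e then action_of (e%:R%:M) w p v
  else \matrix_(r, x) u (inl (inl (inr (w, p, v, (r, x))))).

Definition par_coords (u : {ffun Bv -> k}) j : 'rV[k]_D :=
  \row_r u (inl (inr (j, r))).

Definition par_map (s : Sg) (u : {ffun Bv -> k}) j : 'rV[k]_D := par_coords u j *m par_basis s u (vp j).

Definition par_row (s : Sg) (u : {ffun Bv -> k}) v (x : T) : 'rV[k]_D :=
  par_coords u x.1 *m par_action s u (vp x.1) x.2 v.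

Definition par_sel (s : Sg) v r := s.1.2 (v, r).

Definition par_selected (s : Sg) (u : {ffun Bv -> k}) v := selected (par_sel s v) (par_row s u v).

Definition par_coef (s : Sg) (u : {ffun Bv -> k}) i (x : T) : k :=
  u (inr (i, x)) * \det (par_selected s u (vm i)) -
  \sum_(r | par_sel s (vm i) r == Some x)
    ((\sum_x' u (inr (i, x')) *: par_row s u (vm i) x') *m
       \adj (par_selected s u (vm i))) 0 r.

Definition par (s : Sg) (u : {ffun Bv -> k}) (y : Av) : k :=
  match y with
  | inl (i, x) => par_coef s u i x
  | inr l => par_map s u (s.2 l).1 0 (s.2 l).2
  end.

(** One parameter space serves all strata, the coordinates foreign to stratum [s] being 0. The
    inactive entries of d are those that Cramer's rule recovers. *)
Definition par_active (s : Sg) : {set Bv} :=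
  [set y : Bv | match y with
     | inl (inl _) => s.1.1 == None
     | inl (inr (j, r)) => par_sel s (vp j) r != None
     | inr (i, x) => [forall r, par_sel s (vm i) r != Some x]
     end].

Lemma polyfun_mulmx (I : finType) m1 m2 m3 (A : {ffun I -> k} -> 'M[k]_(m1, m2))
    (B : {ffun I -> k} -> 'M[k]_(m2, m3)) :
  (forall i j, polyfun (fun u => A u i j)) -> (forall i j, polyfun (fun u => B u i j)) ->
  forall i j, polyfun (fun u => (A u *m B u) i j).
Proof.
move=> hA hB i j.
apply: (eq_polyfun _ (polyfun_sum xpredT (fun l => polyfunM (hA i l) (hB l j)))) => u.
by rewrite mxE.
Qed.

Lemma polyfun_entry (I : finType) m1 m2 (f : {ffun I -> k} -> 'I_m1 -> 'I_m2 -> k) i j :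
  polyfun (fun u => f u i j) -> polyfun (fun u => (\matrix_(i, j) f u i j) i j).
Proof. by move=> hf; apply: (eq_polyfun _ hf) => u; rewrite mxE. Qed.

Lemma polyfun_par s y : polyfun (fun u => par s u y).
Proof.
have hb v r x : polyfun (fun u => par_basis s u v r x).
  rewrite /par_basis; case: s.1.1 => [e|]; first exact: polyfun_cst.
  by apply: polyfun_entry; apply: polyfun_coord.
have ha w p v r x : polyfun (fun u => par_action s u w p v r x).
  rewrite /par_action; case: s.1.1 => [e|]; first exact: polyfun_cst.
  by apply: polyfun_entry; apply: polyfun_coord.
have hc j i r : polyfun (fun u => par_coords u j i r).
  by apply: polyfun_entry; apply: polyfun_coord.
have hr v x i r : polyfun (fun u => par_row s u v x i r).
  exact: polyfun_mulmx.
have hs v i r : polyfun (fun u => par_selected s u v i r).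
  apply: polyfun_entry; case: (par_sel s v i) => [x|] /=; first exact: hr.
  exact: polyfun_cst.
case: y => [[i x]|l] /=; last exact: polyfun_mulmx.
apply: polyfunD; first by apply: polyfunM; [apply: polyfun_coord|apply: polyfun_det].
apply: polyfunN; apply: polyfun_sum => r; apply: polyfun_mulmx => [i' r'|i' j'].
  apply: (eq_polyfun (f := fun u => \sum_x' u (inr (i, x')) * par_row s u (vm i) x' i' r')).
    by move=> u; rewrite summxE; apply: eq_bigr => x' _; rewrite [RHS]mxE.
  by apply: polyfun_sum => x'; apply: polyfunM; [apply: polyfun_coord | apply: hr].
exact: polyfun_adj.
Qed.

(** At vertex v, the [l v] selected rows leave [l v] coordinates to each phi_j and take [l v]
    entries away from each column of d. *)
Lemma card_par_active (s : Sg) (l : 'I_n -> nat) :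
  (forall v, l v <= D)%N ->
  (forall v r, (par_sel s v r != None) = (r < l v)%N) ->
  (forall v r r' x, par_sel s v r = Some x -> par_sel s v r' = Some x -> r = r') ->
  (#|par_active s| + \sum_i l (vm i) =
   (if s.1.1 == None then #|{: Cv}| else 0) + \sum_j l (vp j) + #|{: 'I_b * T}|)%N.
Proof.
move=> lD hsel inj.
have cl v : (\sum_(r < D) (par_sel s v r != None) = l v)%N.
  rewrite (eq_bigr (fun r : 'I_D => if (r < l v)%N then 1%N else 0%N)); last first.
    by move=> r _; rewrite hsel; case: (_ < _)%N.
  by rewrite -big_mkcond (big_ord_narrow (lD v)) sum1_card card_ord.
have ch v : (\sum_(x : T) [forall r, par_sel s v r != Some x] + l v = #|{: T}|)%N.
  rewrite -cl (eq_bigr (fun r => \sum_(x : T) (par_sel s v r == Some x) : nat)%N); last first.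
    move=> r _; case: (par_sel s v r) => [x|]; last by rewrite big1.
    by rewrite (bigD1 x) //= eqxx big1 // => x' /negbTE hx; rewrite eq_sym; case: eqP => // -[/eqP]; rewrite hx.
  rewrite exchange_big -big_split /= -sum1_card; apply: eq_bigr => x _.
  case: (boolP [forall r, _]) => [/forallP hr|].
    by rewrite big1 // => r _; rewrite (negbTE (hr r)).
  rewrite negb_forall => /existsP[r]; rewrite negbK => /eqP hr.
  rewrite (bigD1 r) //= hr eqxx big1 // => r' rr'; apply/eqP; rewrite eqb0.
  by apply: contra rr' => /eqP hr'; apply/eqP/(inj v r' r x).
have -> : #|par_active s| = ((if s.1.1 == None then #|{: Cv}| else 0) +
    \sum_j l (vp j) + \sum_(i < b) \sum_(x : T) [forall r, par_sel s (vm i) r != Some x])%N.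
  rewrite -sum1_card big_mkcond big_sumType /= big_sumType /=; congr (_ + _ + _)%N.
  - under eq_bigr => y _ do rewrite inE.
    by case: eqP => _; rewrite ?sum1_card // big1.
  - under [RHS]eq_bigr => j _ do rewrite -cl.
    by rewrite pair_bigA; apply: eq_bigr => -[j r] _; rewrite inE; case: eqP.
  - by rewrite pair_bigA; apply: eq_bigr => -[i x] _; rewrite inE; case: ifP.
rewrite -addnA -big_split /=; congr (_ + _)%N; rewrite (eq_bigr (fun _ => #|{: T}|)); last by move=> i _; apply: ch.
by rewrite sum_nat_const [in RHS]card_prod.
Qed.

(** Since hom(d, M) >= h, there is a phi with the prescribed entries [sc]. The submodule that it
    generates determines the stratum, and the bound assumed for this submodule makes the stratum
    smaller than the target. *)
Lemma par_surjective t (sc : 'I_h -> k) :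
  is_module Y ->
  (forall U : 'M[k]_D, stable Y U ->
     (\sum_j ldim Y U (vp j) + (if (\rank U == 0%N) || (\rank U == D) then 0 else #|{: Cv}|)
       < h + \sum_i ldim Y U (vm i))%N) ->
  (h <= hdim Y t)%N ->
  exists2 s, (#|par_active s| < #|{: Av}|)%N & exists2 u : {ffun Bv -> k},
    (forall y, y \notin par_active s -> u y = 0) &
    forall y, par s u y = match y with inl q => t q | inr l => sc l end.
Proof.
move=> modY hU hh.
have [g0 /(_ sc)[z zK zs]] := kernel_coordinates hh.
have [phiE phit] := kernel_rows modY zK.
pose phi j : 'rV_D := submxrow z j.
(* The row space of [G] is the submodule generated by phi: it contains phi_j because phi_j is fixed
   by [videm Y (vp j)], a combination of the [Y p]. *)
pose G : 'M_(#|{: T}|, D) := \matrix_i (phi (enum_val i).1 *m Y (enum_val i).2).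
pose U := <<G>>%MS.
have rowG j p : (phi j *m Y p <= U)%MS.
  rewrite genmxE; have -> : phi j *m Y p = row (enum_rank (j, p)) G.
    by rewrite rowK enum_rankK.
  exact: row_sub.
have stU : stable Y U.
  move=> p; rewrite (eqmxMr _ (genmxE _)); apply/row_subP => i.
  rewrite row_mul rowK -mulmxA modY.1 mulmx_sumr; apply: summx_sub => q _.
  by rewrite -scalemxAr scalemx_sub.
have phiU j : (phi j <= U *m videm Y (vp j))%MS.
  have e : phi j *m videm Y (vp j) = phi j by apply: phiE.
  by rewrite -e submxMr // -e; apply: submx_videm.
pose fl := if \rank U == 0%N then Some false else if \rank U == D then Some true else None.
(* [stdbase] depends on the matrix and not only on its row space, so a [U] of rank 0 or D is
   replaced by the very matrix 0 or 1 that [par_basis] uses. *)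
pose V : 'M_D := if fl is Some e then e%:R%:M else U.
have eqUV : (V :=: U)%MS.
  rewrite /V /fl; case: eqP => [/eqP|_].
    by rewrite mxrank_eq0 => /eqP -> /=; rewrite mulr0n raddf0.
  by case: eqP => // /eqP rU; apply: eqmx_sym; apply/eqmxP; rewrite submx1 sub1mx /row_full rU.
have rV v : \rank (V *m videm Y v) = ldim Y U v by rewrite (eqmxMr _ eqUV).
pose cc j : 'rV_D := coords (V *m videm Y (vp j)) (phi j).
have ccK j : cc j *m basis_of V (vp j) = phi j.
  by apply: coordsK; rewrite (eqmxMr _ eqUV).
pose Z v (x : T) := cc x.1 *m action_of V (vp x.1) x.2 v.
have ZK v x : Z v x *m basis_of V v = phi x.1 *m Y x.2 *m videm Y v.
  rewrite /Z -mulmxA coordsK; first by rewrite -(ccK x.1) -!mulmxA.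
  apply: submxMr.
  apply: submx_trans (submxMr _ (stdbase_sub _)) _; rewrite (eqmxMr _ (eqmxMr _ eqUV)).
  rewrite eqUV; apply: submx_trans (stU x.2); apply: submxMr.
  exact: submx_videm.
have Zpid v x : Z v x *m pid_mx (ldim Y U v) = Z v x.
  by rewrite -rV /Z -mulmxA coords_pid.
have GE v : G *m videm Y v = \matrix_(i < #|{: T}|) Z v (enum_val i) *m basis_of V v.
  by apply/row_matrixP => i; rewrite !row_mul !rowK ZK.
have lZ v : (ldim Y U v <= \rank (\matrix_(i < #|{: T}|) Z v (enum_val i)))%N.
  by rewrite /ldim (eqmxMr _ (genmxE _)) GE mxrankM_maxl.
have /fin_all_exists[sel hsel] v := select_rows (Zpid v) (lZ v).
have trel i : \sum_x t (i, x) *: Z (vm i) x = 0.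
  apply: (@stdbase_inj _ _ _ (V *m videm Y (vm i))).
    rewrite rV mulmx_suml; apply: eq_bigr => x _; by rewrite -scalemxAl Zpid.
  rewrite mulmx_suml -[RHS](phit i); apply: eq_bigr => x _.
  by rewrite -scalemxAl ZK.
have /fin_all_exists[y hy] i : exists y : T -> k,
    (forall x, (exists r, sel (vm i) r = Some x) -> y x = 0) /\
    forall x, t (i, x) = y x * \det (selected (sel (vm i)) (Z (vm i))) -
      \sum_(r | sel (vm i) r == Some x)
        ((\sum_x' y x' *: Z (vm i) x') *m \adj (selected (sel (vm i)) (Z (vm i)))) 0 r.
  have [_ inj d0] := hsel (vm i).
  by have [y0 h1 h2] := relation_param inj d0 (trel i); exists y0.
pose s : Sg := (fl, [ffun vr => sel vr.1 vr.2],
   [ffun l => (tagnat.sig1 (g0 l), tagnat.sig2 (g0 l))]).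
pose u : {ffun Bv -> k} := [ffun w => match w with
  | inl (inl (inl (v, r, x))) => if fl == None then basis_of V v r x else 0
  | inl (inl (inr (w, p, v, (r, x)))) => if fl == None then action_of V w p v r x else 0
  | inl (inr (j, r)) => cc j 0 r
  | inr (i, x) => y i x
  end].
have uB v : par_basis s u v = basis_of V v.
  rewrite /par_basis /= /V; case hfl: fl => [e|] //.
  by apply/matrixP => r x; rewrite mxE ffunE hfl /= /V hfl.
have uA w p v : par_action s u w p v = action_of V w p v.
  rewrite /par_action /= /V; case hfl: fl => [e|] //.
  by apply/matrixP => r x; rewrite mxE ffunE hfl /= /V hfl.
have uC j : par_coords u j = cc j by apply/rowP => r; rewrite mxE ffunE.
have uZ v x : par_row s u v x = Z v x by rewrite /par_row uC uA.
have uS v r : par_sel s v r = sel v r by rewrite /par_sel ffunE.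
have uSel v : par_selected s u v = selected (sel v) (Z v).
  apply/matrixP => r r'; rewrite !mxE uS.
  by case: (sel v r) => //= x; rewrite uZ.
have act_card := @card_par_active s (ldim Y U) _ _ _.
exists s.
  have {}act_card : (#|par_active s| + \sum_i ldim Y U (vm i) =
      (if fl == None then #|{: Cv}| else 0) + \sum_j ldim Y U (vp j) + #|{: 'I_b * T}|)%N.
    apply: act_card => [v|v r|v r r' x]; first exact: rank_leq_col.
      by rewrite uS; case: (hsel v).
    by rewrite !uS; case: (hsel v) => _ inj _; apply: inj.
  have := hU U stU.
  have efl : (fl == None) = ~~ ((\rank U == 0%N) || (\rank U == D)).
    by rewrite /fl; case: (\rank U == 0%N) => //; case: (\rank U == D).
  rewrite efl if_neg in act_card.
  have -> : #|{: Av}| = (#|{: 'I_b * T}| + h)%N by rewrite card_sum card_ord.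
  move: act_card; case: ifP => _; lia.
exists u => [w|[[i x]|l]].
- rewrite inE ffunE; case: w => [[[[[v r] x]|[[[w p] v] [r x]]]|[j r]]|[i x]].
  + by move/negbTE => /= ->.
  + by move/negbTE => /= ->.
  + rewrite negbK uS => hr; have [hl _ _] := hsel (vp j).
    have := hl r; rewrite hr => /esym/negbT; rewrite -leqNgt => rl.
    rewrite /cc -coords_pid rV mxE big1 // => r' _; rewrite [pid_mx _ _ _]mxE.
    case: eqP => [->|]; last by rewrite mulr0.
    by rewrite ltnNge rl mulr0.
  + rewrite negb_forall => /existsP[r]; rewrite negbK uS => /eqP hr.
    by apply: (hy i).1; exists r.
- rewrite /= /par_coef uSel (hy i).2 ffunE; congr (_ - _).
  apply: eq_big => [r|r _]; first by rewrite uS.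
  congr ((_ *m _) _ _); apply: eq_bigr => x' _; by rewrite ffunE uZ.
rewrite /= /par_map uC uB ffunE /= ccK -zs mxE.
by rewrite tagnat.sig2K.
Qed.

(** Let [F] vanish on all small strata but not at [x0]. With the last h coordinates frozen at those
    of [x0], it is still a nonzero function of d, and [par_surjective] with these values makes it
    vanish wherever hom(d, M) >= h. *)
Lemma generic_hdim_lt :
  is_module Y ->
  (forall U : 'M[k]_D, stable Y U ->
     (\sum_j ldim Y U (vp j) + (if (\rank U == 0%N) || (\rank U == D) then 0 else param_count)
       < h + \sum_i ldim Y U (vm i))%N) ->
  generic (fun t => hdim Y t < h)%N.
Proof.
move=> modY hU.
have A0 : (0 < #|{: Av}|)%N.
  rewrite card_sum card_ord; case: (posnP h) => [h0|]; last by lia.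
  have st0 : stable Y 0 by move=> p; rewrite mul0mx sub0mx.
  have := hU 0 st0; rewrite h0 [X in (_ < 0 + X)%N]big1 // => i _.
  by rewrite /ldim mul0mx mxrank0.
(* Large strata are cut down to the parameter 0 to meet the dimension hypothesis; [par_surjective]
   yields small ones only. *)
pose act s := if (#|par_active s| < #|{: Av}|)%N then par_active s else set0.
have [s|F pF [[x0 Fx0] hF]] := images_in_hypersurface natk_inj (act := act) polyfun_par _ A0.
  by rewrite /act; case: ifP => //; rewrite cards0.
pose join (t : {ffun 'I_b * T -> k}) : {ffun Av -> k} :=
  [ffun y => match y with inl q => t q | inr l => x0 (inr l) end].
exists (fun t => F (join t)).
  case: pF => e hF'; exists e => t t'.
  have [p sp hp] := hF' (join t) [ffun y => if y is inl q then t' q else 0].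
  exists p => // z; rewrite -hp; congr F; apply/ffunP => -[q|l]; rewrite !ffunE //.
  by rewrite mulr0 addr0.
split=> [|t].
  exists [ffun q => x0 (inl q)]; congr (is_true (F _ != 0)): Fx0.
  by apply/ffunP => -[q|l]; rewrite !ffunE.
apply: contraNT; rewrite -leqNgt => hh.
have [s hs [u us hu]] := par_surjective (fun l => x0 (inr l)) modY hU hh.
have := hF s u; rewrite /act hs => /(_ us) <-.
by apply/eqP; congr F; apply/ffunP => y; rewrite !ffunE hu; case: y.
Qed.

End Dimension.

(** * Submodules and quotient modules in coordinates *)

Section Subquotient.
Variables (D l l2 : nat) (Y : 'I_P -> 'M[k]_D).
Variables (J : 'M[k]_(l, D)) (A : 'M[k]_(D, l)) (Q : 'M[k]_(D, l2)) (B : 'M[k]_(l2, D)).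
Hypotheses (JA : J *m A = 1%:M) (BQ : B *m Q = 1%:M) (split1 : A *m J + Q *m B = 1%:M).
Hypothesis (JQ : J *m Q = 0) (stJ : forall p, (J *m Y p <= J)%MS).

Definition subact p : 'M[k]_l := J *m Y p *m A.
Definition quotact p : 'M[k]_l2 := B *m Y p *m Q.

Lemma subactE p : subact p *m J = J *m Y p.
Proof.
by case/submxP: (stJ p) => z hz; rewrite /subact hz -!mulmxA (mulmxA J) JA mul1mx.
Qed.

Lemma quotactE p : Q *m quotact p = Y p *m Q.
Proof.
rewrite /quotact !mulmxA; have -> : Q *m B = 1%:M - A *m J by rewrite -split1 [X in X - _]addrC addrK.
rewrite !mulmxBl mul1mx -!mulmxA (mulmxA J).
by case/submxP: (stJ p) => z ->; rewrite -!mulmxA JQ !mulmx0 subr0.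
Qed.

Lemma sub_videm v : videm subact v *m J = J *m videm Y v.
Proof.
rewrite /videm mulmx_suml mulmx_sumr; apply: eq_bigr => q _.
by rewrite -scalemxAl -scalemxAr subactE.
Qed.

Lemma quot_videm v : Q *m videm quotact v = videm Y v *m Q.
Proof.
rewrite /videm mulmx_suml mulmx_sumr; apply: eq_bigr => q _.
by rewrite -scalemxAl -scalemxAr quotactE.
Qed.

Lemma J_free : row_free J.
Proof. by apply/row_freeP; exists A. Qed.

Lemma Q_inj m (x y : 'M[k]_(l2, m)) : Q *m x = Q *m y -> x = y.
Proof. by move=> /(congr1 (mulmx B)); rewrite !mulmxA BQ !mul1mx. Qed.

Lemma sub_is_module : is_module Y -> is_module subact.
Proof.
move=> [mY idY]; split=> [p q|v]; apply: (row_free_inj J_free).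
  rewrite -mulmxA subactE mulmxA subactE -mulmxA mY mulmx_sumr mulmx_suml.
  by apply: eq_bigr => r _; rewrite -scalemxAr -scalemxAl subactE.
by rewrite -mulmxA sub_videm mulmxA sub_videm -mulmxA idY.
Qed.

Lemma quot_is_module : is_module Y -> is_module quotact.
Proof.
move=> [mY idY]; split=> [p q|v]; apply: Q_inj.
  rewrite mulmxA quotactE -mulmxA quotactE mulmxA mY mulmx_sumr mulmx_suml.
  by apply: eq_bigr => r _; rewrite -scalemxAr -scalemxAl quotactE.
by rewrite mulmxA quot_videm -mulmxA quot_videm mulmxA idY.
Qed.

(** The three modules share their structure constants, so the same t presents them all and left
    exactness of Hom(coker d, -) applies. *)
Lemma hdim_exact t : is_module Y -> (hdim Y t <= hdim subact t + hdim quotact t)%N.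
Proof.
move=> [_ idY].
have freeJ m : row_free (bdiag m J).
  by apply/row_freeP; exists (bdiag m A); rewrite mul_bdiag JA bdiag1.
apply: (@rank_ker_exact _ _ _ _ _ _ _ _ _ _ _ _ _ (bdiag a J) (bdiag b J) (bdiag a Q) (bdiag b Q)) => //.
- have e1 : bdiag a A *m bdiag a J + bdiag a Q *m bdiag a B = 1%:M.
    by rewrite !mul_bdiag -bdiagD split1 bdiag1.
  rewrite -[X in (X <= _)%MS]mulmx1 -e1 mulmxDr !mulmxA mulmx_ker mul0mx addr0.
  exact: submxMl.
- rewrite mul_mxdiag_mxblock; apply: eq_mxblock => i j.
  by case: eqP => _; rewrite ?mulmx0 // conform_mx_id idY.
- rewrite mxdiag_bdiag bdiag_mxdiag; apply: eq_mxblock => i j.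
  by case: eqP => // ->; rewrite sub_videm.
- rewrite mxdiag_bdiag bdiag_mxdiag; apply: eq_mxblock => i j.
  by case: eqP => // ->; rewrite quot_videm.
- rewrite mul_mxblock_bdiag mul_bdiag_mxblock; apply: eq_mxblock => i j.
  rewrite mulmx_suml mulmx_sumr; apply: eq_bigr => p _.
  rewrite -scalemxAl -scalemxAr; congr (_ *: _).
  by rewrite -mulmxA sub_videm mulmxA -(mulmxA (videm subact _)) subactE mulmxA sub_videm !mulmxA.
rewrite mul_mxblock_bdiag mul_bdiag_mxblock; apply: eq_mxblock => i j.
rewrite mulmx_suml mulmx_sumr; apply: eq_bigr => p _.
rewrite -scalemxAl -scalemxAr; congr (_ *: _).
by rewrite -mulmxA -quot_videm mulmxA -(mulmxA (videm Y _)) -quotactE mulmxA -quot_videm !mulmxA.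
Qed.

Lemma sub_lift (U : 'M[k]_l) : stable subact U ->
  stable Y <<U *m J>>%MS /\ forall v, ldim Y <<U *m J>>%MS v = ldim subact U v.
Proof.
move=> stU; split=> [p|v].
  rewrite (eqmxMr _ (genmxE _)) genmxE -mulmxA -subactE mulmxA.
  exact/submxMr/stU.
by rewrite /ldim (eqmxMr _ (genmxE _)) -mulmxA -sub_videm mulmxA mxrankMfree ?J_free.
Qed.

(** [J + U *m B] is the preimage of U in M; the rank formula for multiplication by [Q] splits its
    dimension at each vertex. *)
Lemma quot_lift (U : 'M[k]_l2) : is_module Y -> stable quotact U ->
  stable Y (J + U *m B)%MS /\
  forall v, ldim Y (J + U *m B)%MS v = (ldim Y <<J>>%MS v + ldim quotact U v)%N.
Proof.
move=> [_ idY] stU; have stUB : stable Y (J + U *m B)%MS.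
  move=> p; rewrite addsmxMr addsmx_sub; apply/andP; split.
    exact: submx_trans (stJ p) (addsmxSl _ _).
  have -> : U *m B *m Y p = (U *m B *m Y p *m A) *m J + U *m quotact p *m B.
    by rewrite /quotact -[LHS]mulmx1 -split1 mulmxDr !mulmxA.
  apply: addmx_sub_adds; first exact: submxMl.
  exact/submxMr/stU.
split=> // v; set S := (J + U *m B)%MS; rewrite /ldim.
rewrite -(mxrank_mul_ker (S *m videm Y v) Q) addnC; congr (_ + _)%N.
  apply: eqmx_rank; apply/andP; split; rewrite (eqmxMr _ (genmxE _)).
    set Z := (_ :&: _)%MS.
    have ZJ : (Z <= J)%MS.
      rewrite -[Z]mulmx1 -split1 mulmxDr !mulmxA.
      have -> : Z *m Q = 0 by apply/sub_kermxP; apply: capmxSr.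
      by rewrite mul0mx addr0 submxMl.
    have -> : Z = Z *m videm Y v.
      have /submxP[y ->] : (Z <= S *m videm Y v)%MS by apply: capmxSl.
      by rewrite -!mulmxA idY.
    exact: submxMr.
  rewrite sub_capmx; apply/andP; split; first exact/submxMr/addsmxSl.
  apply/sub_kermxP; rewrite -mulmxA -quot_videm mulmxA JQ mul0mx //.
rewrite -mulmxA -quot_videm mulmxA; apply: eqmx_rank.
have SQ : (S *m Q :=: U)%MS.
  apply: eqmx_trans (addsmxMr _ _ _) _; rewrite JQ -mulmxA BQ mulmx1.
  exact: adds0mx.
by rewrite !(eqmxMr _ SQ) submx_refl.
Qed.

End Subquotient.

End Presentation.

(** * Growth of hom(m delta, M) in m *)

Lemma sum_vlist (d : 'I_n -> int) (F : 'I_n -> nat) :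
  (\sum_(j < size (vlist d)) F (@vof n d j) = \sum_v posp (d v) * F v)%N.
Proof.
rewrite -(big_tnth _ _ (vlist d) xpredT F) big_flatten big_map big_enum /=.
by apply: eq_bigr => v _; rewrite big_nseq iter_addn_0 mulnC.
Qed.

Lemma posp_diff (z : int) : (posp z)%:Z - (posp (- z))%:Z = z.
Proof. by case: z => [[|m]|m] //=; rewrite ?subr0 // sub0r NegzE. Qed.

Lemma sum_vlist_diff (d : 'I_n -> int) (F : 'I_n -> nat) :
  (\sum_(j < size (vlist d)) F (@vof n d j))%N%:Z -
  (\sum_(i < size (vlist (fun v => - d v))) F (@vof n (fun v => - d v) i))%N%:Z =
  \sum_v d v * (F v)%:Z.
Proof.
rewrite !sum_vlist !(big_morph Posz PoszD (erefl _)) -sumrB; apply: eq_bigr => v _.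
by rewrite !PoszM -mulrBl posp_diff.
Qed.

Definition pairing_dim D (Y : 'I_P -> 'M[k]_D) (delta : 'I_n -> int) U : int :=
  \sum_v delta v * (ldim Y U v)%:Z.

Definition hom_mul D (Y : 'I_P -> 'M[k]_D) (delta : 'I_n -> int) (m : nat) t : nat :=
  hdim (@vof n (fun v => m%:Z * delta v)) (@vof n (fun v => - (m%:Z * delta v))) Y t.

Arguments hom_mul {D} Y delta m t.

(** The bound is claimed for all large m, so that the inductive bounds for L and M/L can be added at
    a common m and a common t. *)
Lemma generic_hom_mul D (Y : 'I_P -> 'M[k]_D) (delta : 'I_n -> int) (F : int) :
  is_module Y -> (forall U, stable Y U -> pairing_dim Y delta U <= F) ->
  exists m0, forall m, (m0 <= m)%N ->
    generic (fun t => (hom_mul Y delta m t)%:Z <= m%:Z * F).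
Proof.
elim/ltn_ind: D Y F => D IH Y F modY hF.
case: (excluded_middle_informative (exists U0 : 'M_D,
  [/\ stable Y U0, \rank U0 != 0%N, \rank U0 != D & pairing_dim Y delta U0 = F])).
  move=> [U0 [stU0 r0 rD dU0]].
  (* [A *m J] projects M onto L along the row space of [Pi], and the factors of the idempotent [Pi]
     give coordinates on M/L. *)
  pose J := row_base U0; pose A := pinvmx J; pose Pi := 1%:M - A *m J.
  have JA : J *m A = 1%:M by apply: mulmxVp; apply: row_base_free.
  have JPi : J *m Pi = 0 by rewrite mulmxBr mulmx1 mulmxA JA mul1mx subrr.
  have PiPi : Pi *m Pi = Pi by rewrite {1}/Pi mulmxBl mul1mx -mulmxA JPi mulmx0 subr0.
  pose Q := col_base Pi; pose B := row_base Pi.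
  have BQ : B *m Q = 1%:M by apply: idempotent_split.
  have QB : Q *m B = Pi by apply: mulmx_base.
  have JQ : J *m Q = 0 by rewrite -[LHS]mulmx1 -BQ mulmxA -(mulmxA J) QB JPi mul0mx.
  have split1 : A *m J + Q *m B = 1%:M by rewrite QB addrC subrK.
  have stJ p : (J *m Y p <= J)%MS by rewrite (eqmxMr _ (eq_row_base _)) eq_row_base.
  have rJ v : ldim Y <<J>>%MS v = ldim Y U0 v.
    by rewrite /ldim (eqmxMr _ (genmxE _)) (eqmxMr _ (eq_row_base _)).
  have lL : (\rank U0 < D)%N by rewrite ltn_neqAle rD rank_leq_col.
  have lQ : (\rank Pi < D)%N.
    rewrite ltn_neqAle rank_leq_col andbT; apply: contra r0 => /eqP hr.
    have uPi : Pi \in unitmx by rewrite -row_full_unit /row_full hr.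
    by rewrite -(eq_row_base U0) -/J -[J](mulmxK uPi) JPi mul0mx mxrank0.
  have [U stU|mL hL] := IH _ lL (subact Y J A) F (sub_is_module JA stJ modY).
    have [st e] := sub_lift JA stJ stU; apply: le_trans (hF _ st).
    by rewrite le_eqVlt; apply/orP; left; apply/eqP/eq_bigr => v _; rewrite e.
  (* The preimage in M of a submodule of M/L pairs to at most F, and L alone already gives F: this
     leaves the bound 0. *)
  have [U stU|mQ hQ] := IH _ lQ (quotact Y Q B) 0 (quot_is_module BQ split1 JQ stJ modY).
    have [st e] := quot_lift BQ split1 JQ stJ modY stU.
    have := hF _ st; rewrite -{1}dU0 -subr_le0 -sumrB; congr (_ <= _).
    by apply: eq_bigr => v _; rewrite e rJ -mulrBr PoszD addrAC subrr add0r.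
  exists (maxn mL mQ) => m; rewrite geq_max => /andP[/hL gL /hQ gQ].
  apply: generic_imp (generic_and natk_inj gL gQ) => t [tL tQ].
  have : (hom_mul Y delta m t <=
      hom_mul (subact Y J A) delta m t + hom_mul (quotact Y Q B) delta m t)%N.
    exact: hdim_exact.
  move: tL tQ; rewrite mulr0; lia.
move=> irr.
have F0 : 0 <= F.
  have st0 : stable Y 0 by move=> p; rewrite mul0mx sub0mx.
  have := hF 0 st0; rewrite /pairing_dim big1 // => v _.
  by rewrite /ldim mul0mx mxrank0 mulr0.
have [f eF] : exists f : nat, F = f%:Z by exists `|F|%N; rewrite gez0_abs.
(* Take h = m f + 1. For 0 and M the required inequality holds by this extra 1. Any other U pairs to
   at most F - 1, since the pairing is integral, and the m thus gained pays for its [param_count D]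
   parameters. *)
exists (param_count D) => m hm.
have : generic (fun t => hom_mul Y delta m t < (m * f).+1)%N; last first.
  by apply: generic_imp => t; rewrite eF -PoszM lez_nat ltnS.
rewrite /hom_mul; apply: generic_hdim_lt => // U stU.
have := sum_vlist_diff (fun v => m%:Z * delta v) (ldim Y U).
have -> : \sum_v m%:Z * delta v * (ldim Y U v)%:Z = m%:Z * pairing_dim Y delta U.
  by rewrite mulr_sumr; apply: eq_bigr => v _; rewrite mulrA.
move: (\sum_(j < _) _)%N (\sum_(i < _) _)%N => S1 S2 hS.
have hU := hF U stU.
case: ifP => [_|/negbT].
  have : m%:Z * pairing_dim Y delta U <= m%:Z * f%:Z by rewrite ler_wpM2l -?eF.
  by rewrite -hS; lia.
rewrite negb_or => /andP[r0 rD].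
have hU' : pairing_dim Y delta U <= F - 1.
  move: hU; rewrite le_eqVlt => /orP[/eqP e|]; last by lia.
  by case: irr; exists U.
have : m%:Z * pairing_dim Y delta U <= m%:Z * (f%:Z - 1) by rewrite ler_wpM2l -?eF.
by rewrite -hS; lia.
Qed.

End Modules.

(** * Convex hulls *)

Section FourierMotzkin.
Variable R : realFieldType.

Lemma separating_value (I : finType) (L U : pred I) (l u : I -> R) :
  (forall p q, U p -> L q -> l q <= u p) ->
  exists x, (forall q, L q -> l q <= x) /\ (forall p, U p -> x <= u p).
Proof.
move=> h; case: (pickP L) => [q0 Lq0|L0].
  case: (Order.TotalTheory.arg_maxP l Lq0) => q Lq hq.
  by exists (l q); split=> [q' /hq|p Up] //; apply: h.
case: (pickP U) => [p0 Up0|U0].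
  case: (Order.TotalTheory.arg_minP u Up0) => p Up hp.
  by exists (u p); split=> [q|p' /hp] //; rewrite L0.
by exists 0; split=> i; rewrite ?L0 ?U0.
Qed.

(* Farkas' lemma with integer coefficients and right-hand sides in R: P is any
   cone of (coefficients, right-hand side) pairs containing the constraints. *)
Lemma farkas_int (N : nat) (P : (nat -> int) -> R -> Prop) (I : finType)
    (a : I -> nat -> int) (b : I -> R) :
  P (fun _ => 0) 0 ->
  (forall a1 b1 a2 b2 (z1 z2 : int), 0 <= z1 -> 0 <= z2 -> P a1 b1 -> P a2 b2 ->
     P (fun j => z1 * a1 j + z2 * a2 j) (z1%:~R * b1 + z2%:~R * b2)) ->
  (forall i, P (a i) (b i)) ->
  (exists lam : nat -> R, forall i, \sum_(j < N) (a i j)%:~R * lam j <= b i) \/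
  (exists a' b', [/\ P a' b', forall j, (j < N)%N -> a' j = 0 & b' < 0]).
Proof.
elim: N P I a b => [|N IH] P I a b P0 Padd hP.
  case: (pickP (fun i => b i < 0)) => [i bi|hb].
    by right; exists (a i), (b i).
  by left; exists (fun _ => 0) => i; rewrite big_ord0 leNgt hb.
(* Fourier-Motzkin elimination of variable N: constraints free of it are kept, pairs with
   coefficients of opposite signs are combined, and all other indices carry the void constraint 0 <=
   0. *)
pose a' (x : I + I * I) : nat -> int := match x with
  | inl i => if a i N == 0 then a i else fun _ => 0
  | inr (p, q) => if (0 < a p N) && (a q N < 0)
      then fun j => (- a q N) * a p j + a p N * a q j else fun _ => 0
  end.
pose b' (x : I + I * I) : R := match x with
  | inl i => if a i N == 0 then b i else 0
  | inr (p, q) => if (0 < a p N) && (a q N < 0)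
      then (- a q N)%:~R * b p + (a p N)%:~R * b q else 0
  end.
(* A certificate found after the elimination must still have coefficient 0 at N. *)
pose P' a1 b1 := P a1 b1 /\ a1 N = 0.
have [|||[lam hlam]|[a1 [b1 [[Pab aN] a0 b0]]]] := IH P' _ a' b'.
- by [].
- move=> a1 b1 a2 b2 z1 z2 z1p z2p [h1 e1] [h2 e2]; split; first exact: Padd.
  by rewrite e1 e2 !mulr0.
- case=> [i|[p q]]; rewrite /P' /=; first by case: eqP.
  case: ifP => // /andP[ap aq]; split; last by rewrite mulNr mulrC addNr.
  by apply: Padd => //; [rewrite oppr_ge0; apply: ltW | apply: ltW].
- left; pose s i := \sum_(j < N) (a i j)%:~R * lam j.
  pose w i := (b i - s i) / (a i N)%:~R.
  have [|x [hl hu]] := @separating_value I (fun i => a i N < 0) (fun i => 0 < a i N) w w.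
    move=> p q ap aq; have := hlam (inr (p, q)); rewrite /= ap aq /=.
    have -> : \sum_(j < N) (- a q N * a p j + a p N * a q j)%:~R * lam j =
        (- a q N)%:~R * s p + (a p N)%:~R * s q.
      rewrite !mulr_sumr -big_split; apply: eq_bigr => j _.
      by rewrite /= rmorphD !rmorphM mulrDl !mulrA.
    rewrite /w; have ap' : 0 < (a p N)%:~R :> R by rewrite ltr0z.
    have aq' : 0 < - (a q N)%:~R :> R by rewrite oppr_gt0 ltrz0.
    move=> h; rewrite -[leLHS]mulrNN -invrN ler_pdivrMr // mulrAC ler_pdivlMr //.
    by move: h; rewrite rmorphN /=; lra.
  exists (fun j => if j == N then x else lam j) => i.
  rewrite big_ord_recr /= eqxx (eq_bigr (fun j : 'I_N => (a i j)%:~R * lam j)); last first.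
    by move=> j _; rewrite ltn_eqF.
  rewrite -/(s i) -lerBrDl; case: (ltrgtP (a i N) 0) => ai.
  + by have := hl i ai; rewrite /w ler_ndivrMr ?ltrz0 // (mulrC x).
  + by have := hu i ai; rewrite /w ler_pdivlMr ?ltr0z // (mulrC x).
  + by rewrite ai mul0r subr_ge0; have := hlam (inl i); rewrite /= ai eqxx.
- right; exists a1, b1; split=> // j; rewrite ltnS leq_eqVlt => /orP[/eqP->|] //.
  exact: a0.
Qed.

(** If there are no weights, Farkas' lemma gives an integral affine function that is nonnegative at
    every [dv x] and negative at gamma. The coordinates of gamma occur in right-hand sides only, so
    they may be irrational. *)
Lemma hull_of_support (n : nat) (T : finType) (dv : T -> 'I_n -> nat) (gamma : 'I_n -> R) :
  (forall (delta : 'I_n -> int) (F : int),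
     (forall x, \sum_v delta v * (dv x v)%:Z <= F) -> pairing delta gamma <= F%:~R) ->
  exists lam : T -> R, [/\ forall x, 0 <= lam x, \sum_x lam x = 1 &
    forall v, gamma v = \sum_x lam x * (dv x v)%:R].
Proof.
move=> hgamma.
pose ext (f : T -> int) (j : nat) : int := oapp (fun o : 'I_#|T| => f (enum_val o)) 0 (insub j).
have extE f (o : 'I_#|T|) : ext f o = f (enum_val o) by rewrite /ext valK.
(* An affine function delta + kappa has value b at gamma and bounds the coefficients a at the points
   [dv x]; an inequality, not an equality, so as to include the constraints that weights are
   nonnegative. *)
pose P (a : nat -> int) (b : R) := exists (delta : 'I_n -> int) (kappa : int),
  b = pairing delta gamma + kappa%:~R /\
  forall o : 'I_#|T|, a o <= \sum_v delta v * (dv (enum_val o) v)%:Z + kappa.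
pose sg (e : bool) : int := if e then 1 else -1.
pose I : finType := (T + bool + 'I_n * bool)%type.
pose a (i : I) := match i with
  | inl (inl x) => ext (fun y => - (x == y)%:R)
  | inl (inr e) => ext (fun _ => sg e)
  | inr (v, e) => ext (fun y => sg e * (dv y v)%:Z)
  end.
pose b (i : I) : R := match i with
  | inl (inl x) => 0
  | inl (inr e) => (sg e)%:~R
  | inr (v, e) => (sg e)%:~R * gamma v
  end.
have pair0 : pairing (fun _ => 0) gamma = 0.
  by rewrite /pairing big1 // => v _; rewrite mul0r.
have sum0 (x : T) : \sum_v (0 : int) * (dv x v)%:Z = 0.
  by rewrite big1 // => v _; rewrite mul0r.
have [|||[lam hlam]|[a' [b' [[delta [kappa [eb ha]]] a0 b0]]]] := @farkas_int #|T| P I a b.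
- exists (fun _ => 0), 0; rewrite pair0 addr0; split=> // o.
  by rewrite sum0.
- move=> a1 b1 a2 b2 z1 z2 z1p z2p [d1 [k1 [-> h1]]] [d2 [k2 [-> h2]]].
  exists (fun v => z1 * d1 v + z2 * d2 v), (z1 * k1 + z2 * k2); split=> [|o].
    rewrite !mulrDr rmorphD !rmorphM addrACA; congr (_ + _).
    rewrite /pairing !mulr_sumr -big_split; apply: eq_bigr => v _ /=.
    by rewrite rmorphD !rmorphM mulrDl !mulrA.
  apply: le_trans (lerD (ler_wpM2l z1p (h1 o)) (ler_wpM2l z2p (h2 o))) _.
  rewrite !mulrDr addrACA lerD2r !mulr_sumr -big_split /= le_eqVlt; apply/orP; left.
  by apply/eqP/eq_bigr => v _; rewrite mulrDl !mulrA.
- case=> [[x|e]|[v e]].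
  + exists (fun _ => 0), 0; rewrite pair0 addr0; split=> // o.
    by rewrite sum0 addr0 /a extE oppr_le0; case: eqP.
  + exists (fun _ => 0), (sg e); rewrite pair0 add0r; split=> // o.
    by rewrite sum0 add0r /a extE.
  + exists (fun w => if w == v then sg e else 0), 0; split=> [|o].
      rewrite addr0 /pairing (bigD1 v) //= eqxx big1 ?addr0 // => w /negbTE ->.
      by rewrite mul0r.
    rewrite addr0 (bigD1 v) //= eqxx big1 ?addr0 ?extE // => w /negbTE ->.
    by rewrite mul0r.
- pose mu (x : T) := lam (enum_rank x).
  have sumE f : \sum_(j < #|T|) (ext f j)%:~R * lam j = \sum_x (f x)%:~R * mu x.
    rewrite [RHS](reindex (@enum_val T predT)) /=; last first.
      by exists enum_rank => x _; rewrite ?enum_valK ?enum_rankK.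
    by apply: eq_bigr => j _; rewrite extE /mu enum_valK.
  have sgE e f : \sum_x (sg e * f x)%:~R * mu x = (sg e)%:~R * \sum_x (f x)%:~R * mu x.
    by rewrite mulr_sumr; apply: eq_bigr => x _; rewrite rmorphM mulrA.
  exists mu; split=> [x||v].
  + have := hlam (inl (inl x)); rewrite /= sumE (bigD1 x) //= eqxx big1 => [|y /negbTE yx].
      by rewrite addr0 rmorphN mulN1r oppr_le0.
    by rewrite eq_sym yx oppr0 mul0r.
  + have h e : (sg e)%:~R * \sum_x mu x <= (sg e)%:~R.
      have := hlam (inl (inr e)); rewrite /= sumE -mulr_sumr //.
    apply/eqP; rewrite eq_le; have := h true; have := h false.
    by rewrite /= !rmorphN !rmorph1 !mul1r !mulN1r lerN2 => -> ->.
  + have h e : (sg e)%:~R * (\sum_x mu x * (dv x v)%:R) <= (sg e)%:~R * gamma v.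
      have := hlam (inr (v, e)); rewrite /= sumE sgE.
      by under eq_bigr => x _ do rewrite mulrC.
    apply/eqP; rewrite eq_le; have := h true; have := h false.
    by rewrite /= !rmorphN !rmorph1 !mul1r !mulN1r lerN2 => -> ->.
exfalso; have hd x : 0 <= \sum_v delta v * (dv x v)%:Z + kappa.
  by have := ha (enum_rank x); rewrite a0 // enum_rankK.
have h : pairing (fun v => - delta v) gamma <= kappa%:~R.
  apply: hgamma => x; rewrite -subr_ge0 -sumrN addrC.
  move: (hd x); congr (_ <= _ + _).
  by apply: eq_bigr => v _; rewrite mulNr opprK.
have pN : pairing (fun v => - delta v) gamma = - pairing delta gamma.
  by rewrite /pairing -sumrN; apply: eq_bigr => v _; rewrite rmorphN mulNr.
by move: b0 h; rewrite pN eb => b0 h; lra.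
Qed.

End FourierMotzkin.

(** * Representations of the quiver *)

(** Each element outside the current span raises a bounded dimension. [S] may be infinite: it will
    be the type of paths. *)
Lemma finite_spanning (k : fieldType) (vT : vectType k) (S : Type) (g : S -> vT) :
  exists (P : nat) (w : 'I_P -> S), forall s,
    exists coef : 'I_P -> k, g s = \sum_p coef p *: g (w p).
Proof.
have H d : exists l : seq S, (forall s, g s \in <<[seq g x | x <- l]>>%VS) \/
    (d <= \dim <<[seq g x | x <- l]>>)%N.
  elim: d => [|d [l [cl|dl]]]; first by exists [::]; right.
    by exists l; left.
  case: (classic (forall s, g s \in <<[seq g x | x <- l]>>%VS)) => [cl|/not_all_ex_not[s /negP hs]].
    by exists l; left.
  exists (s :: l); right; apply: leq_ltn_trans dl _.
  rewrite ltnNge; apply: contra hs => hd.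
  have /eqP -> : (<<[seq g x | x <- l]>> == <<[seq g x | x <- s :: l]>>)%VS.
    by rewrite eqEdim hd andbT /= span_cons addvSr.
  by rewrite memv_span ?mem_head.
have [l [cl|]] := H (\dim {:vT}).+1; last first.
  by rewrite ltnNge dimvS ?subvf.
exists (size l), (tnth (in_tuple l)) => s.
exists (fun p => coord (map_tuple g (in_tuple l)) p (g s)).
rewrite [LHS](coord_span (X := map_tuple g (in_tuple l)) (cl s)).
by apply: eq_bigr => p _; rewrite -tnth_nth tnth_map.
Qed.

Lemma gen_min_le (T : Type) (f : T -> nat) t0 t : (gen_min f t0 <= f t)%N.
Proof.
rewrite /gen_min; case: ex_minnP => h _; apply.
by case: excluded_middle_informative => // -[]; exists t.
Qed.

Lemma gen_min_attained (T : Type) (f : T -> nat) t0 : exists t, gen_min f t0 = f t.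
Proof.
rewrite /gen_min; case: ex_minnP => h; case: excluded_middle_informative => // -[t ft] _ _.
by exists t.
Qed.

(** * The algebra of matrices spanned by paths *)

Section PathAlgebra.
Variables (k : fieldType) (n : nat) (Ar : finType) (src tgt : Ar -> 'I_n) (D : nat).
Variables (E : 'I_n -> 'M[k]_D) (X : Ar -> 'M[k]_D).
Hypotheses (idE : forall v, E v *m E v = E v)
  (orthE : forall v w, v != w -> E v *m E w = 0)
  (XE : forall a, X a = E (src a) *m X a *m E (tgt a)).

Lemma evw_cat s1 s2 : evw X (s1 ++ s2) = evw X s1 *m evw X s2.
Proof. by elim: s1 => [|a s1 IH] /=; rewrite ?mul1mx // IH mulmxA. Qed.

(** End vertices are recorded because the empty word acts as the identity: e_v is the element of
    [(v, [::], v)]. *)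
Definition path_elt (s : 'I_n * seq Ar * 'I_n) : 'M[k]_D :=
  E s.1.1 *m evw X s.1.2 *m E s.2.

Lemma E_path_elt v s u :
  E v *m path_elt s *m E u = if (s.1.1 == v) && (s.2 == u) then path_elt s else 0.
Proof.
rewrite /path_elt; case: (eqVneq s.1.1 v) => [->|h] /=; last first.
  by rewrite !mulmxA orthE 1?eq_sym // !mul0mx.
case: (eqVneq s.2 u) => [->|h] /=; first by rewrite -!mulmxA idE !mulmxA idE.
by rewrite -!mulmxA orthE // !mulmx0.
Qed.

Lemma evw_E s v : s != [::] -> evw X s *m E v = evw X s \/ evw X s *m E v = 0.
Proof.
elim: s => [//|a [|b s] IH] _ /=.
  rewrite mulmx1 XE; case: (eqVneq (tgt a) v) => [<-|h]; [left|right].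
    by rewrite -mulmxA idE.
  by rewrite -mulmxA orthE ?mulmx0.
by case: (IH isT) => /= e; [left|right]; rewrite -mulmxA e ?mulmx0.
Qed.

Lemma path_eltM s1 s2 : path_elt s1 *m path_elt s2 = 0 \/
  exists s, path_elt s1 *m path_elt s2 = path_elt s.
Proof.
case: s1 s2 => [[v w] u] [[v' w'] u']; rewrite /path_elt /=.
have -> : E v *m evw X w *m E u *m (E v' *m evw X w' *m E u') =
    E v *m evw X w *m (E u *m E v') *m evw X w' *m E u' by rewrite !mulmxA.
case: (eqVneq u v') => [<-|h]; last by left; rewrite orthE // mulmx0 !mul0mx.
rewrite idE; case: (eqVneq w [::]) => [->|w0] /=.
  rewrite mulmx1; case: (eqVneq v u) => [<-|h]; last by left; rewrite orthE // !mul0mx.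
  by right; exists (v, w', u'); rewrite idE.
rewrite -[E v *m _ *m E u]mulmxA; case: (evw_E u w0) => ->; last by left; rewrite mulmx0 !mul0mx.
by right; exists (v, w ++ w', u'); rewrite evw_cat mulmxA.
Qed.

(** Paths span a subalgebra of the D by D matrices, so finitely many of them span it. This family
    may be dependent; [c] and [beta] are one choice of coefficients. *)
Lemma path_algebra_basis : exists (P : nat) (w : 'I_P -> 'I_n * seq Ar * 'I_n) c beta,
  [/\ is_module c beta (fun p => path_elt (w p)),
      forall v, videm beta (fun p => path_elt (w p)) v = E v
    & forall s, exists coef : 'I_P -> k, path_elt s = \sum_p coef p *: path_elt (w p)].
Proof.
have [P [w hw]] := finite_spanning path_elt.
have [c hc] : exists c : 'I_P * 'I_P -> 'I_P -> k, forall pq,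
    path_elt (w pq.1) *m path_elt (w pq.2) = \sum_r c pq r *: path_elt (w r).
  apply: (@fin_all_exists _ _ (fun pq c => path_elt (w pq.1) *m path_elt (w pq.2) =
     \sum_r c r *: path_elt (w r))) => pq.
  case: (path_eltM (w pq.1) (w pq.2)) => [->|[s ->]]; last exact: hw.
  by exists (fun _ => 0); rewrite big1 // => r _; rewrite scale0r.
have [beta hb] : exists beta : 'I_n -> 'I_P -> k, forall v,
    E v = \sum_r beta v r *: path_elt (w r).
  apply: (@fin_all_exists _ _ (fun v b => E v = \sum_r b r *: path_elt (w r))) => v.
  have [b hb] := hw (v, [::], v); exists b; apply: etrans hb.
  by rewrite /path_elt /= mulmx1 idE.
have vE v : videm beta (fun p => path_elt (w p)) v = E v by rewrite /videm -hb.
exists P, w, (fun p q => c (p, q)), beta; split=> //; split=> [p q|v].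
  exact: (hc (p, q)).
by rewrite vE.
Qed.

Lemma subrep_evw U s : is_subrep E X U -> (U *m evw X s <= U)%MS.
Proof.
case/andP=> _ /forallP hX; elim/last_ind: s => [|s a IH] /=; first by rewrite mulmx1.
rewrite -cats1 evw_cat /= mulmx1 mulmxA.
exact: submx_trans (submxMr _ IH) (hX a).
Qed.

Lemma dimkerP_rank (delta : 'I_n -> int) a :
  dimkerP E X a =
  \rank ((\mxdiag_(j < size (vlist delta)) E (@vof n delta j)) :&: kermx
    (\mxblock_(j < size (vlist delta), i < size (vlist (fun v => - delta v)))
       ev E X (@vof n delta j) (@vof n (fun v => - delta v) i) (a j i)))%MS.
Proof.
rewrite /dimkerP /=; set W := \mxdiag_j _; set Phi := \mxblock_(j, i) _.
by rewrite -[in LHS](mxrank_mul_ker W Phi) addKn.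
Qed.

(** Rank-nullity for the map Hom(P_+, L) -> Hom(P_-, L) induced by d, whose kernel lies in the one
    for M. *)
Lemma pairing_le_dimkerP U (delta : 'I_n -> int) a : is_subrep E X U ->
  \sum_v delta v * (subdim E U v)%:Z <= (dimkerP E X (delta := delta) a)%:Z.
Proof.
move=> hU; have /andP[/forallP hE _] := hU.
rewrite -sum_vlist_diff dimkerP_rank.
set W := \mxdiag_j _; set Phi := \mxblock_(j, i) _.
pose WU := \mxdiag_(j < size (vlist delta)) (U *m E (@vof n delta j)).
have mulEU v : U *m E v *m E v = U *m E v by rewrite -mulmxA idE.
have rWU : \rank WU = (\sum_(j < size (vlist delta)) subdim E U (@vof n delta j))%N.
  exact: rank_mxdiag.
have sWU : (WU <= W)%MS.
  apply/submxP; exists (\mxdiag_(j < size (vlist delta)) (U *m E (@vof n delta j))).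
  rewrite [RHS]mul_mxdiag_mxblock; apply: eq_mxblock => i j.
  by case: eqP => _; rewrite ?mulmx0 // !conform_mx_id mulEU.
have sPhi : (\rank (WU *m Phi) <=
    \sum_(i < size (vlist (fun v => (- delta v)%R))) subdim E U (@vof n (fun v => (- delta v)%R) i))%N.
  rewrite -rank_mxdiag; apply: mxrankS.
  rewrite /WU /Phi mul_mxdiag_mxblock.
  have [C hC] : exists C : 'I_(size (vlist delta)) -> 'I_(size (vlist (fun v => - delta v))) -> 'M[k]_D,
      forall j i, U *m E (@vof n delta j) *m ev E X (@vof n delta j) (@vof n (fun v => - delta v) i) (a j i)
       = C j i *m (U *m E (@vof n (fun v => - delta v) i)).
    have h j i : exists C : 'M[k]_D, U *m E (@vof n delta j) *m
        ev E X (@vof n delta j) (@vof n (fun v => - delta v) i) (a j i)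
       = C *m (U *m E (@vof n (fun v => - delta v) i)).
      apply/submxP; rewrite /ev !mulmxA; apply: submxMr; rewrite mulEU /evf.
      rewrite mulmx_sumr; apply: summx_sub => x _; rewrite -scalemxAr scalemx_sub //.
      by apply: submx_trans (submxMr _ (hE _)) _; apply: subrep_evw.
    have /fin_all_exists[C hC] j := fin_all_exists (h j).
    by exists C.
  under eq_mxblock => j i do rewrite hC.
  by rewrite -mul_mxblock_mxdiag submxMl.
have := mxrank_mul_ker WU Phi.
have : (\rank (WU :&: kermx Phi) <= \rank (W :&: kermx Phi))%N.
  by apply: mxrankS; apply: capmxS.
by rewrite rWU; lia.
Qed.

End PathAlgebra.

(** * The Newton polytope *)

Section NewtonPolytope.
Variables (k : fieldType) (n : nat) (Ar : finType) (src tgt : Ar -> 'I_n) (D : nat).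
Variables (E : 'I_n -> 'M[k]_D) (X : Ar -> 'M[k]_D) (R : realFieldType).
Hypothesis natk_inj : injective (fun m : nat => m%:R : k).
Hypotheses (idE : forall v, E v *m E v = E v)
  (orthE : forall v w, v != w -> E v *m E w = 0)
  (XE : forall a, X a = E (src a) *m X a *m E (tgt a)).

Lemma homP_multiple_le (delta : 'I_n -> int) (F : int) :
  (forall U, is_subrep E X U -> \sum_v delta v * (subdim E U v)%:Z <= F) ->
  exists m : nat, (homP E X (fun v => m.+1%:Z * delta v))%:Z <= m.+1%:Z * F.
Proof.
move=> hF; have [P [w [c [beta [modY vE spanY]]]]] := path_algebra_basis idE orthE XE.
pose Y p := path_elt E X (w p).
have subY U : stable Y U -> is_subrep E X U.
  move=> stU; apply/andP; split; [apply/forallP => v | apply/forallP => a].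
    by rewrite -vE; apply: submx_videm.
  have -> : X a = path_elt E X (src a, [:: a], tgt a) by rewrite /path_elt /= mulmx1 -XE.
  have [coef ->] := spanY (src a, [:: a], tgt a).
  rewrite mulmx_sumr; apply: summx_sub => p _.
  by rewrite -scalemxAr; apply: scalemx_sub; apply: stU.
have [|m0 hm0] := @generic_hom_mul k natk_inj n P c beta D Y delta F modY.
  move=> U /subY hU; have := hF U hU; congr (_ <= _).
  by apply: eq_bigr => v _; rewrite /ldim vE.
(* [homP] is a minimum, so a single point of the generic set is enough. *)
have [t ht] := generic_ex (hm0 _ (leqnSn m0)); exists m0.
set d := fun v => m0.+1%:Z * delta v.
(* These lists hold bare words, to which [ev] supplies the end vertices of the block. Hence the
   filter on recorded end vertices; by [E_path_elt] the discarded p contribute 0 to [pblock]. *)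
pose a (j : 'I_(size (vlist d))) (i : 'I_(size (vlist (fun v => - d v)))) :=
  [seq (t (i, (j, p)), (w p).1.2) | p <- enum 'I_P &
     ((w p).1.1 == @vof n d j) && ((w p).2 == @vof n (fun v => - d v) i)].
apply: le_trans ht; rewrite lez_nat.
apply: leq_trans (gen_min_le _ _ a) _.
rewrite dimkerP_rank /hom_mul /hdim /pdom /pmap.
under eq_mxdiag => j do rewrite -vE.
rewrite -/d; under eq_mxblock => j i.
  have -> : ev E X (@vof n d j) (@vof n (fun v => - d v) i) (a j i) =
      pblock beta (@vof n d) (@vof n (fun v => - d v)) Y t j i.
    rewrite /ev /evf /a /pblock big_map big_filter big_enum_cond /= mulmx_sumr mulmx_suml.
    rewrite big_mkcond; apply: eq_bigr => p _; rewrite !vE E_path_elt //.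
    case: ifP => [/andP[/eqP <- /eqP <-]|_]; last by rewrite scaler0.
    by rewrite -scalemxAr -scalemxAl.
  over.
by [].
Qed.

Theorem newton_polytope (gamma : 'I_n -> R) :
  in_conv_hull (fun U => is_subrep E X U) (subdim E) gamma <->
  (forall delta : 'I_n -> int, pairing delta gamma <= (homP E X delta)%:R).
Proof.
split=> [[m [lam [U [lam0 hU lam1 hg]]]] delta|hg].
  have -> : pairing delta gamma =
      \sum_i lam i * (\sum_v delta v * (subdim E (U i) v)%:Z)%:~R.
    under [RHS]eq_bigr => i _ do rewrite rmorph_sum mulr_sumr.
    rewrite exchange_big; apply: eq_bigr => v _.
    rewrite hg mulr_sumr; apply: eq_bigr => i _.
    by rewrite rmorphM /= mulrCA -pmulrn.
  have [a ha] := gen_min_attained (dimkerP E X (delta := delta)) (fun _ _ => [::]).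
  have -> : (homP E X delta)%:R = \sum_i lam i * (dimkerP E X a)%:R.
    by rewrite -mulr_suml lam1 mul1r /homP ha.
  apply: ler_sum => i _.
  apply: ler_wpM2l => //; rewrite [leRHS]pmulrn ler_int.
  exact: pairing_le_dimkerP.
pose T : finType := {ffun 'I_n -> 'I_D.+1}.
(* There may be infinitely many subrepresentations: one is chosen for each dimension vector, and 0
   serves as default where there is none. *)
have /fin_all_exists[Ux hUx] : forall x : T, exists U, is_subrep E X U /\
    ((exists2 U', is_subrep E X U' & forall v, subdim E U' v = x v) ->
      forall v, subdim E U v = x v).
  move=> x; case: (classic (exists2 U', is_subrep E X U' & forall v, subdim E U' v = x v)).
    by move=> [U' hU' e]; exists U'.
  move=> no; exists 0; split=> [|/no //].
  by apply/andP; split; apply/forallP => v; rewrite mul0mx sub0mx.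
have [delta F hF|lam [lam0 lam1 hlam]] := @hull_of_support R n T (fun x => subdim E (Ux x)) gamma.
  have hFU U : is_subrep E X U -> \sum_v delta v * (subdim E U v)%:Z <= F.
    move=> hU; pose x : T := [ffun v => inord (subdim E U v)].
    have xE v : subdim E U v = x v by rewrite ffunE inordK // ltnS rank_leq_row.
    have ex : exists2 U', is_subrep E X U' & forall v, subdim E U' v = x v by exists U.
    apply: le_trans (hF x); rewrite le_eqVlt; apply/orP; left; apply/eqP.
    by apply: eq_bigr => v _; rewrite (hUx x).2 // xE.
  (* Only a multiple of delta is controlled, so the inequality assumed for that multiple is divided
     by [m.+1]. *)
  have [m hm] := homP_multiple_le hFU.
  have m0 : 0 < m.+1%:R :> R by rewrite ltr0n.
  rewrite -(ler_pM2l m0).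
  have -> : m.+1%:R * pairing delta gamma = pairing (fun v => m.+1%:Z * delta v) gamma.
    by rewrite mulr_sumr; apply: eq_bigr => v _; rewrite rmorphM /= mulrA -pmulrn.
  apply: le_trans (hg _) _.
  by rewrite pmulrn [m.+1%:R]pmulrn -rmorphM ler_int.
exists #|T|, (fun i => lam (enum_val i)), (fun i => Ux (enum_val i)).
have re (G : T -> R) : \sum_x G x = \sum_(i < #|T|) G (enum_val i).
  rewrite (reindex (@enum_val T predT)) //=.
  by exists enum_rank => x _; rewrite ?enum_valK ?enum_rankK.
split=> [i|i||v] //.
- by have [] := hUx (enum_val i).
- by rewrite -lam1 re.
by rewrite hlam re.
Qed.

End NewtonPolytope.

(** * Dual representations and quotients *)

Section Duality.
Variables (k : fieldType) (n : nat) (Ar : finType) (D : nat).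
Implicit Types (E : 'I_n -> 'M[k]_D) (X : Ar -> 'M[k]_D).

Definition annihilator (U : 'M[k]_D) : 'M[k]_D := kermx U^T.

Lemma annihilator_stable (U M : 'M[k]_D) :
  (U *m M <= U)%MS -> (annihilator U *m M^T <= annihilator U)%MS.
Proof.
case/submxP=> Z hZ; apply/sub_kermxP.
by rewrite -mulmxA -trmx_mul hZ trmx_mul mulmxA mulmx_ker mul0mx.
Qed.

Lemma annihilator_subrep E X U : is_subrep E X U ->
  is_subrep (fun v => (E v)^T) (fun a => (X a)^T) (annihilator U).
Proof.
move=> /andP[/forallP hE /forallP hX].
by apply/andP; split; apply/forallP => ?; apply: annihilator_stable.
Qed.

(** As [M] is idempotent and preserves U, the left-hand space is the row space of [M^T] cut by the
    kernel of [U^T]. For [M = E v] this makes the annihilator the dual of the quotient. *)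
Lemma rank_annihilator (U M : 'M[k]_D) : M *m M = M -> (U *m M <= U)%MS ->
  \rank (annihilator U *m M^T) = (\rank M - \rank (U *m M))%N.
Proof.
move=> idM stU; have idMT : M^T *m M^T = M^T by rewrite -trmx_mul idM.
rewrite -[\rank M]mxrank_tr -[\rank (U *m M)]mxrank_tr trmx_mul.
rewrite -(mxrank_mul_ker M^T U^T) addKn; apply: eqmx_rank; apply/andP; split.
  by rewrite sub_capmx submxMl annihilator_stable.
set Z := (_ :&: _)%MS; have -> : Z = Z *m M^T.
  have /submxP[y ->] : (Z <= M^T)%MS by apply: capmxSl.
  by rewrite -mulmxA idMT.
exact/submxMr/capmxSr.
Qed.

Lemma evw_tr X s : evw (fun a => (X a)^T) (rev s) = (evw X s)^T.
Proof.
elim: s => [|a s IH] /=; first by rewrite trmx1.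
by rewrite rev_cons -cats1 evw_cat IH /= mulmx1 trmx_mul.
Qed.

Definition rev_paths (f : seq (k * seq Ar)) := [seq (x.1, rev x.2) | x <- f].

Lemma ev_tr E X v u f :
  ev (fun v => (E v)^T) (fun a => (X a)^T) u v (rev_paths f) = (ev E X v u f)^T.
Proof.
rewrite /ev !trmx_mul mulmxA; congr (_ *m _ *m _).
rewrite /evf big_map raddf_sum.
by apply: eq_bigr => x _; rewrite /= evw_tr linearZ.
Qed.

Lemma rev_pathsK : involutive rev_paths.
Proof.
move=> f; rewrite /rev_paths -map_comp -[RHS]map_id; apply: eq_map => -[c s] /=.
by rewrite revK.
Qed.

Lemma dimkerI_tr E X (delta : 'I_n -> int) a :
  dimkerI E X (delta := delta) a =
  dimkerP (fun v => (E v)^T) (fun a => (X a)^T) (delta := delta)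
    (fun j i => rev_paths (a j i)).
Proof.
rewrite /dimkerI /dimkerP /=.
under [in RHS]eq_mxblock => j i do rewrite ev_tr.
by rewrite -tr_mxdiag -tr_mxblock -trmx_mul !mxrank_tr.
Qed.

(** Path reversal is an involution, so both minima run over the same values. *)
Lemma homI_tr E X (delta : 'I_n -> int) :
  homI E X delta = homP (fun v => (E v)^T) (fun a => (X a)^T) delta.
Proof.
apply/eqP; rewrite eqn_leq /homI /homP; apply/andP; split.
  have [a ->] := gen_min_attained
    (dimkerP (fun v => (E v)^T) (fun a => (X a)^T) (delta := delta)) (fun _ _ => [::]).
  apply: leq_trans (gen_min_le _ _ (fun j i => rev_paths (a j i))) _.
  rewrite dimkerI_tr leq_eqVlt; apply/orP; left; apply/eqP.
  rewrite /dimkerP /=; congr (_ - \rank (_ *m _))%N.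
  by apply: eq_mxblock => j i; rewrite rev_pathsK.
have [a ->] := gen_min_attained (dimkerI E X (delta := delta)) (fun _ _ => [::]).
by rewrite dimkerI_tr gen_min_le.
Qed.

Lemma in_conv_hull_image (R : numDomainType) (T T' : Type) (Q : T -> Prop) (Q' : T' -> Prop)
    (dv : T -> 'I_n -> nat) (dv' : T' -> 'I_n -> nat) (h : T -> T') (gamma : 'I_n -> R) :
  (forall x, Q x -> Q' (h x) /\ forall v, dv' (h x) v = dv x v) ->
  in_conv_hull Q dv gamma -> in_conv_hull Q' dv' gamma.
Proof.
move=> hh [m [lam [x [lam0 Qx lam1 hg]]]]; exists m, lam, (h \o x); split=> // [i|v].
  by have [] := hh _ (Qx i).
rewrite hg; apply: eq_bigr => i _; have [_ e] := hh _ (Qx i).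
by rewrite /= e.
Qed.

(** Annihilators turn quotients into subrepresentations of the dual, and the same construction leads
    back because transposition is an involution. *)
Lemma quotient_hull_tr (R : numDomainType) E X (gamma : 'I_n -> R) :
  (forall v, E v *m E v = E v) ->
  in_conv_hull (fun U => is_subrep E X U) (quotdim E) gamma <->
  in_conv_hull (fun U => is_subrep (fun v => (E v)^T) (fun a => (X a)^T) U)
    (subdim (fun v => (E v)^T)) gamma.
Proof.
move=> idE; split; apply: (in_conv_hull_image (h := annihilator)) => U hU.
  split=> [|v]; first exact: annihilator_subrep.
  by have /andP[/forallP hE _] := hU; apply: rank_annihilator.
have /andP[/forallP hE /forallP hX] := hU; split=> [|v].
  apply/andP; split; apply/forallP => x.
    by rewrite -[E x]trmxK annihilator_stable.
  by rewrite -[X x]trmxK annihilator_stable.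
rewrite /quotdim /subdim -{2}[E v]trmxK rank_annihilator //; last by rewrite -trmx_mul idE.
by rewrite mxrank_tr subKn // -[leqRHS]mxrank_tr mxrankM_maxr.
Qed.

End Duality.

Theorem theorem4p1
  (k : closedFieldType) (chark0 : [pchar k] =i pred0)
  (n : nat) (Ar : finType) (src tgt : Ar -> 'I_n)
  (r : nat) (Rel : 'I_r -> seq (k * seq Ar))
  (Hadm : admissible src tgt Rel)
  (D : nat) (E : 'I_n -> 'M[k]_D) (X : Ar -> 'M[k]_D)
  (HM : is_rep src tgt Rel E X)
  (R : realFieldType) :
  (forall gamma : 'I_n -> R,
     in_conv_hull (fun U => is_subrep E X U) (subdim E) gamma <->
     (forall delta : 'I_n -> int, pairing delta gamma <= (homP E X delta)%:R))
  /\
  (forall gamma : 'I_n -> R,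
     in_conv_hull (fun U => is_subrep E X U) (quotdim E) gamma <->
     (forall delta : 'I_n -> int, pairing delta gamma <= (homI E X delta)%:R)).
Proof.
have natk_inj : injective (fun m : nat => m%:R : k).
  have nz (m : nat) : (m.+1%:R : k) != 0 by have /pcharf0P -> := chark0.
  have le (i j : nat) : (i < j)%N -> i%:R != j%:R :> k.
    move=> ij; rewrite eq_sym -subr_eq0 -natrB ?(ltnW ij) //.
    by rewrite -(prednK (_ : 0 < j - i)%N) ?subn_gt0.
  move=> i j /eqP e; case: (ltngtP i j) => // /le; first by rewrite e.
  by rewrite eq_sym e.
have [idE orthE _ XE _] := HM; split=> gamma; first exact: (newton_polytope natk_inj idE orthE XE).
apply: iff_trans (quotient_hull_tr X gamma idE) _.
(* The transposes form a representation of the opposite quiver, whence the exchange of [src] and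
   [tgt]. *)
apply: iff_trans (newton_polytope (src := tgt) (tgt := src) natk_inj _ _ _ gamma) _.
- by move=> v; rewrite -trmx_mul idE.
- by move=> v w vw; rewrite -trmx_mul orthE 1?eq_sym // trmx0.
- by move=> a; rewrite {1}XE !trmx_mul mulmxA.
by split=> h delta; [rewrite homI_tr | rewrite -homI_tr].
Qed.
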